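(* Let $c>1$ be a real number which is not an integer and let $m$ be a positive integer. Then the sequence $(\lfloor n^c\rfloor)_{n}$ is $k$-uniformly distributed modulo $m$ for every integer $k$ with $1\le k\le c+1$.
   Context: For positive integers $m,k$, a sequence of integers $(u_n)_n$ is called $k$-uniformly distributed modulo $m$ if for every block $B\in\{0,1,\ldots,m-1\}^k$, \[\lim_{N\to\infty}\frac1N\operatorname{Card}\{n<N : (u_n,u_{n+1},\ldots,u_{n+k-1})\equiv B \pmod m\}=\frac1{m^k},\] where the congruence of $k$-tuples is understood componentwise. *)

(* Defs.v *)
From Stdlib Require Import Reals Lra Lia ZArith List.
Open Scope R_scope.

(* Real power x^c for x >= 0, with the convention 0^c = 0 (c > 0). *)
Definition rpow (x c : R) : R := if Rle_dec x 0 then 0 else Rpower x c.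

Definition floor_pow (c : R) (n : nat) : Z := Int_part (rpow (INR n) c).

Definition block_match_dec (u : nat -> Z) (m : Z) (B : list Z) (n : nat) : bool :=
  forallb (fun i => Z.eqb (Z.modulo (u (n + i)%nat) m) (Z.modulo (nth i B 0%Z) m))
          (seq 0 (length B)).

Definition block_count (u : nat -> Z) (m : Z) (B : list Z) (N : nat) : nat :=
  length (filter (block_match_dec u m B) (seq 0 N)).

Definition k_unif_distr_mod (u : nat -> Z) (m : Z) (k : nat) : Prop :=
  forall B : list Z,
    length B = k ->
    (forall b, In b B -> (0 <= b < m)%Z) ->
    Un_cv (fun N => INR (block_count u m B N) / INR N) (/ (IZR m ^ k)).

(* Main.v *)
Require Import Defs.
From Stdlib Require Import Reals Lra Lia ZArith List FinFun.
From Coquelicot Require Import Complex.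
Open Scope R_scope.

(** The block [(u_n, ..., u_{n+k-1})] modulo [m] is read off the position of the
    point [((n+j)^c / m)_{j<k}] in the torus, so it suffices to prove that these
    points are equidistributed.  For a nonzero integer vector [h], the phase
    [f(n) = sum_j h_j (n+j)^c] has a nonvanishing moment [sum_j h_j j^d] for some
    [d < k <= c + 1] (Vandermonde); for the smallest such [d], [f(x)] behaves like
    a constant times [x^(c-d)], and [c - d] is positive and not an integer.
    Differencing [x |-> f(x+l) - f(x)] raises [d] by one, so van der Corput's
    inequality reduces to [0 < c - d < 1], where summation by parts applies.
    The resulting exponential sum estimates bound the frequency of each block from
    above by [1/m^k], through trigonometric majorants of arcs; since the [m^k]
    blocks exhaust all cases, the upper bounds are limits. *)

(** * Mean-zero sequences and van der Corput's inequality *)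

(** The bound [k <= c + 1] enters through [d <= k - 1 <= c]. Since [c] is not an integer, [d < c],
    so the phase still grows; with [d > c] it would tend to 0 and its exponential sum could not
    cancel. Non-integrality also keeps the generalized binomial coefficient of the leading term
    nonzero through all differencings.

    Phases are handled as formal lists of weights and shifts, a class closed under differencing in
    which the growth is read off the moments: in the Taylor expansion in [1/x] the term of order [i]
    carries the [i]-th moment. No rates are tracked. Cancellation means [o(N)], and this passes
    through van der Corput's inequality because the window length is fixed before [N] grows.

    The majorants are explicit finite averages of Fejer kernels instead of approximants from a
    density theorem. Their mean is a constant coefficient, so no integral appears. *)

Fixpoint csum (f : nat -> C) (n : nat) : C :=
  match n with O => 0%C | S p => (csum f p + f p)%C end.

Fixpoint rsum (f : nat -> R) (n : nat) : R :=
  match n with O => 0 | S p => rsum f p + f p end.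

Lemma csum_ext (f g : nat -> C) n :
  (forall i, (i < n)%nat -> f i = g i) -> csum f n = csum g n.
Proof.
  induction n as [|n IH]; intros H; simpl; [easy|].
  rewrite IH, H; auto.
Qed.

Lemma csum_plus (f g : nat -> C) n :
  csum (fun i => f i + g i)%C n = (csum f n + csum g n)%C.
Proof. induction n as [|n IH]; simpl; [ring|]. rewrite IH; ring. Qed.

Lemma csum_mult_l (a : C) (f : nat -> C) n :
  csum (fun i => a * f i)%C n = (a * csum f n)%C.
Proof. induction n as [|n IH]; simpl; [ring|]. rewrite IH; ring. Qed.

Lemma csum_mult_r (a : C) (f : nat -> C) n :
  csum (fun i => f i * a)%C n = (csum f n * a)%C.
Proof. induction n as [|n IH]; simpl; [ring|]. rewrite IH; ring. Qed.

Lemma csum_conj (f : nat -> C) n :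
  Cconj (csum f n) = csum (fun i => Cconj (f i)) n.
Proof.
  induction n as [|n IH]; simpl.
  - unfold Cconj, RtoC; simpl; rewrite Ropp_0; reflexivity.
  - rewrite Cplus_conj, IH; reflexivity.
Qed.

Lemma csum_const (a : C) n : csum (fun _ => a) n = (RtoC (INR n) * a)%C.
Proof.
  induction n as [|n IH]; [simpl; ring|].
  rewrite S_INR, RtoC_plus; simpl; rewrite IH; ring.
Qed.

Lemma csum_swap (f : nat -> nat -> C) n m :
  csum (fun i => csum (f i) m) n = csum (fun j => csum (fun i => f i j) n) m.
Proof.
  induction n as [|n IH]; simpl.
  - induction m as [|m IHm]; simpl; [easy|]. rewrite <- IHm; ring.
  - rewrite IH, <- csum_plus; reflexivity.
Qed.

Lemma csum_RtoC (f : nat -> R) n : csum (fun i => RtoC (f i)) n = RtoC (rsum f n).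
Proof. induction n as [|n IH]; simpl; [easy|]. rewrite IH, RtoC_plus; easy. Qed.

Lemma csum_single (a : C) b n :
  (b < n)%nat -> csum (fun i => if Nat.eqb b i then a else 0%C) n = a.
Proof.
  assert (Z : forall n, (n <= b)%nat ->
    csum (fun i => if Nat.eqb b i then a else 0%C) n = 0%C).
  { induction n0 as [|p IH]; intros Hp; simpl; [easy|].
    rewrite IH by lia. destruct (Nat.eqb_spec b p); [lia|ring]. }
  induction n as [|n IH]; intros Hb; [lia|]; simpl.
  destruct (Nat.eqb_spec b n) as [->|Hn].
  - rewrite Z by lia; ring.
  - rewrite IH by lia; ring.
Qed.

Lemma rsum_le (f g : nat -> R) n :
  (forall i, (i < n)%nat -> f i <= g i) -> rsum f n <= rsum g n.
Proof.
  induction n as [|n IH]; intros H; simpl; [lra|].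
  apply Rplus_le_compat; auto.
Qed.

Lemma rsum_const (a : R) n : rsum (fun _ => a) n = INR n * a.
Proof.
  induction n as [|n IH]; [simpl; ring|]. rewrite S_INR; simpl; rewrite IH; ring.
Qed.

Lemma rsum_app (f : nat -> R) n m :
  rsum f (n + m) = rsum f n + rsum (fun i => f (n + i)%nat) m.
Proof.
  induction m as [|m IH]; simpl.
  - rewrite Nat.add_0_r; ring.
  - rewrite Nat.add_succ_r; simpl; rewrite IH; ring.
Qed.

Lemma Cmod_csum (f : nat -> C) n : Cmod (csum f n) <= rsum (fun i => Cmod (f i)) n.
Proof.
  induction n as [|n IH]; simpl; [rewrite Cmod_0; lra|].
  eapply Rle_trans; [apply Cmod_triangle|]. lra.
Qed.

Lemma csum_telescope (f : nat -> C) n :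
  csum (fun i => f (S i) - f i)%C n = (f n - f O)%C.
Proof. induction n as [|n IH]; simpl; [ring|]. rewrite IH; ring. Qed.

Lemma rsum_cauchy_schwarz (a : nat -> R) n :
  rsum a n ^ 2 <= INR n * rsum (fun i => a i ^ 2) n.
Proof.
  induction n as [|n IH]; [simpl; lra|].
  rewrite S_INR; cbn [rsum].
  set (s := rsum a n) in *; set (q := rsum (fun i => a i ^ 2) n) in *.
  destruct n as [|n].
  - unfold s, q; simpl; lra.
  - assert (Hn : 0 < INR (S n)) by (apply lt_0_INR; lia).
    set (N := INR (S n)) in *. set (x := a (S n)).
    (* After multiplication by [N] this is [(N x - s)^2 >= 0] combined with the induction hypothesis
       [s^2 <= N q]. *)
    assert (2 * s * x <= q + N * x ^ 2).
    { apply Rmult_le_reg_l with N; [easy|].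
      assert (0 <= (N * x - s) ^ 2) by apply pow2_ge_0. nra. }
    nra.
Qed.

(** [o(N)] in product form, so that [N = 0] needs no separate treatment. *)
Definition mean_zero (z : nat -> C) : Prop :=
  forall eps, 0 < eps -> exists N0, forall N, (N0 <= N)%nat ->
    Cmod (csum z N) <= eps * INR N.

Lemma INR_unbounded (x : R) : exists n, forall N, (n <= N)%nat -> x <= INR N.
Proof.
  destruct (INR_archimed 1 (Rabs x)) as [n Hn]; [lra|].
  exists n; intros N HN. apply le_INR in HN.
  pose proof (Rle_abs x). lra.
Qed.

(* The constant [b] absorbs the contribution of boundary terms. *)
Lemma mean_zero_of_affine_bound (z : nat -> C) :
  (forall eps, 0 < eps -> exists b N0, forall N, (N0 <= N)%nat ->
    Cmod (csum z N) <= eps * INR N + b) -> mean_zero z.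
Proof.
  intros H eps He.
  destruct (H (eps / 2)) as (b & N0 & HN0); [lra|].
  destruct (INR_unbounded (2 * b / eps)) as [N1 HN1].
  exists (max N0 N1); intros N HN.
  specialize (HN0 N ltac:(lia)). specialize (HN1 N ltac:(lia)).
  apply Rmult_le_compat_l with (r := eps / 2) in HN1; [|lra].
  replace (eps / 2 * (2 * b / eps)) with b in HN1 by (field; lra). lra.
Qed.

Lemma mean_zero_plus (z w : nat -> C) :
  mean_zero z -> mean_zero w -> mean_zero (fun n => z n + w n)%C.
Proof.
  intros Hz Hw eps He.
  destruct (Hz (eps / 2)) as [N0 H0]; [lra|].
  destruct (Hw (eps / 2)) as [N1 H1]; [lra|].
  exists (max N0 N1); intros N HN.
  rewrite csum_plus. eapply Rle_trans; [apply Cmod_triangle|].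
  specialize (H0 N ltac:(lia)). specialize (H1 N ltac:(lia)). lra.
Qed.

Lemma mean_zero_mult (a : C) (z : nat -> C) :
  mean_zero z -> mean_zero (fun n => a * z n)%C.
Proof.
  intros Hz eps He.
  pose proof (Cmod_ge_0 a) as Ha.
  destruct (Hz (eps / (Cmod a + 1))) as [N0 H0].
  { apply Rdiv_lt_0_compat; lra. }
  exists N0; intros N HN. specialize (H0 N HN).
  rewrite csum_mult_l, Cmod_mult.
  apply Rle_trans with ((Cmod a + 1) * Cmod (csum z N)).
  - apply Rmult_le_compat_r; [apply Cmod_ge_0|lra].
  - apply Rmult_le_compat_l with (r := Cmod a + 1) in H0; [|lra].
    eapply Rle_trans; [apply H0|]. right; field; lra.
Qed.

Lemma mean_zero_0 : mean_zero (fun _ => 0%C).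
Proof.
  intros eps He; exists O; intros N _.
  rewrite csum_const, Cmult_0_r, Cmod_0.
  apply Rmult_le_pos; [lra|apply pos_INR].
Qed.

Lemma mean_zero_eventually (z w : nat -> C) n0 :
  (forall n, (n0 <= n)%nat -> z n = w n) -> mean_zero w -> mean_zero z.
Proof.
  intros E Hw. apply mean_zero_of_affine_bound; intros eps He.
  destruct (Hw eps He) as [N1 H1].
  exists (Cmod (csum z n0 - csum w n0)), (max n0 N1); intros N HN.
  assert (D : forall k, csum z (n0 + k) = (csum w (n0 + k) + (csum z n0 - csum w n0))%C).
  { induction k as [|k IH].
    - rewrite Nat.add_0_r; ring.
    - rewrite Nat.add_succ_r; simpl. rewrite IH, E by lia. ring. }
  replace N with (n0 + (N - n0))%nat at 1 by lia. rewrite D.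
  replace (n0 + (N - n0))%nat with N by lia.
  eapply Rle_trans; [apply Cmod_triangle|].
  specialize (H1 N ltac:(lia)). lra.
Qed.

Lemma mean_zero_ext (z w : nat -> C) :
  (forall n, z n = w n) -> mean_zero w -> mean_zero z.
Proof. intros E; apply (mean_zero_eventually z w 0); intros; apply E. Qed.

Lemma mean_zero_csum (z : nat -> nat -> C) m :
  (forall i, (i < m)%nat -> mean_zero (z i)) ->
  mean_zero (fun n => csum (fun i => z i n) m).
Proof.
  induction m as [|m IH]; intros H; simpl; [apply mean_zero_0|].
  apply mean_zero_plus; auto.
Qed.

Lemma mean_zero_conj (z : nat -> C) :
  mean_zero z -> mean_zero (fun n => Cconj (z n)).
Proof.
  intros Hz eps He. destruct (Hz eps He) as [N0 H0]; exists N0; intros N HN.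
  rewrite <- csum_conj, Cmod_conj; auto.
Qed.

(** Each unit shift of the window trades [z h] for [z (N + h)], two terms of modulus at most 1. *)
Lemma csum_shift_bound (z : nat -> C) h N :
  (forall n, Cmod (z n) <= 1) ->
  Cmod (csum (fun n => z (n + h)%nat) N - csum z N) <= 2 * INR h.
Proof.
  intros Hz. induction h as [|h IH].
  - rewrite (csum_ext _ z) by (intros; f_equal; lia).
    unfold Cminus; rewrite Cplus_opp_r, Cmod_0; simpl; lra.
  - assert (E : forall N, csum (fun n => z (n + S h)%nat) N =
        (csum (fun n => z (n + h)%nat) N + (z (N + h)%nat - z h))%C).
    { induction N0 as [|M IHM]; simpl; [ring|].
      rewrite IHM. rewrite Nat.add_succ_r. simpl. ring. }
    rewrite E, S_INR.
    replace (_ - _)%C with ((csum (fun n => z (n + h)%nat) N - csum z N)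
      + (z (N + h)%nat + - z h))%C by ring.
    eapply Rle_trans; [apply Cmod_triangle|].
    pose proof (Cmod_triangle (z (N + h)%nat) (- z h)%C) as T.
    rewrite Cmod_opp in T. pose proof (Hz (N + h)%nat). pose proof (Hz h). lra.
Qed.

Lemma mean_zero_shift (z : nat -> C) h :
  (forall n, Cmod (z n) <= 1) -> mean_zero z -> mean_zero (fun n => z (n + h)%nat).
Proof.
  intros B Hz. apply mean_zero_of_affine_bound; intros eps He.
  destruct (Hz eps He) as [N0 H0]. exists (2 * INR h), N0; intros N HN.
  specialize (H0 N HN). pose proof (csum_shift_bound z h N B) as S.
  replace (csum (fun n => z (n + h)%nat) N) with
    (csum z N + (csum (fun n => z (n + h)%nat) N - csum z N))%C by ring.
  eapply Rle_trans; [apply Cmod_triangle|]. lra.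
Qed.

(** A shift of the origin brings the smaller index to 0, and a negative lag is the conjugate of a
    positive one. *)
Lemma mean_zero_correlation (z : nat -> C) h h' :
  (forall n, Cmod (z n) = 1) ->
  (forall l, (1 <= l)%nat -> mean_zero (fun n => z (n + l)%nat * Cconj (z n))%C) ->
  h <> h' -> mean_zero (fun n => z (n + h)%nat * Cconj (z (n + h')%nat))%C.
Proof.
  intros U Hc Hh.
  assert (M : forall l n, Cmod (z (n + l)%nat * Cconj (z n))%C <= 1).
  { intros l n; rewrite Cmod_mult, Cmod_conj, !U; lra. }
  assert (P : forall a b, (a < b)%nat ->
     mean_zero (fun n => z (n + b)%nat * Cconj (z (n + a)%nat))%C).
  { intros a b Hab.
    apply mean_zero_ext with
      (fun n => (fun n => z (n + (b - a))%nat * Cconj (z n))%C (n + a)%nat).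
    - intros n; simpl. do 2 f_equal; lia.
    - apply (mean_zero_shift (fun n => z (n + (b - a))%nat * Cconj (z n))%C);
        [apply M|apply Hc; lia]. }
  destruct (Nat.lt_gt_cases h h') as [[L|L] _]; [easy| |auto].
  apply mean_zero_ext with
    (fun n => Cconj (z (n + h')%nat * Cconj (z (n + h)%nat))%C).
  - intros n; rewrite Cmult_conj, Cconj_conj; ring.
  - apply mean_zero_conj; auto.
Qed.

(* Replace [z n] by the average of [z (n + h)] over [h < H], apply
   Cauchy-Schwarz, and expand the square: the diagonal contributes [N / H],
   the off-diagonal correlations average to 0. *)
Lemma van_der_corput (z : nat -> C) :
  (forall n, Cmod (z n) = 1) ->
  (forall l, (1 <= l)%nat -> mean_zero (fun n => z (n + l)%nat * Cconj (z n))%C) ->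
  mean_zero z.
Proof.
  intros U Hc. apply mean_zero_of_affine_bound; intros eps He.
  (* This size of [H] makes the Cauchy-Schwarz bound [2 H N^2] at most [(eps H N)^2]. *)
  destruct (INR_unbounded (2 / eps ^ 2)) as [H0 HH0].
  set (H := S H0). specialize (HH0 H ltac:(unfold H; lia)).
  assert (HH : 0 < INR H) by (apply lt_0_INR; unfold H; lia).
  assert (He2 : 0 < eps ^ 2) by (apply pow_lt; easy).
  assert (HH2 : 2 <= eps ^ 2 * INR H).
  { apply Rmult_le_compat_l with (r := eps ^ 2) in HH0; [|lra].
    replace (eps ^ 2 * (2 / eps ^ 2)) with 2 in HH0 by (field; lra). easy. }
  set (w := fun n => csum (fun h => z (n + h)%nat) H).
  set (E := fun n => csum (fun h => csum (fun h' =>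
     if Nat.eqb h h' then 0%C else (z (n + h)%nat * Cconj (z (n + h')%nat))%C) H) H).
  assert (HE : mean_zero E).
  { apply (mean_zero_csum (fun h n => csum (fun h' => _) H)); intros h _.
    apply (mean_zero_csum (fun h' n => _)); intros h' _.
    destruct (Nat.eqb_spec h h') as [_|Hd]; [apply mean_zero_0|].
    apply mean_zero_correlation; easy. }
  assert (Hw : forall n, RtoC (Cmod (w n) ^ 2) = (RtoC (INR H) + E n)%C).
  { intros n. rewrite Cmod2_conj. unfold w at 2. rewrite csum_conj.
    rewrite <- csum_mult_l. unfold w.
    rewrite (csum_ext _ (fun h' => csum (fun h => z (n + h)%nat * Cconj (z (n + h')%nat))%C H))
      by (intros; rewrite csum_mult_r; easy).
    rewrite csum_swap. unfold E.
    replace (RtoC (INR H)) with (csum (fun h => csum (fun h' => if Nat.eqb h h' then RtoC 1 else 0%C) H) H).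
    2:{ rewrite (csum_ext _ (fun _ => RtoC 1)).
        - rewrite csum_const; ring.
        - intros; apply csum_single; easy. }
    rewrite <- csum_plus. apply csum_ext; intros h _.
    rewrite <- csum_plus. apply csum_ext; intros h' _.
    destruct (Nat.eqb_spec h h') as [<-|_]; [|ring].
    rewrite <- Cmod2_conj, U. rewrite pow1. ring. }
  (* With tolerance [INR H] the off-diagonal part costs no more than the diagonal, whence the factor
     2 in [Q]. *)
  destruct (HE (INR H) HH) as [N0 HN0].
  exists (2 * INR H), N0; intros N HN. specialize (HN0 N HN).
  pose proof (pos_INR N) as PN.
  assert (Q : rsum (fun n => Cmod (w n) ^ 2) N <= 2 * INR H * INR N).
  { apply Rle_trans with (Cmod (csum (fun n => RtoC (Cmod (w n) ^ 2)) N)).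
    - rewrite csum_RtoC, Cmod_R. apply Rle_abs.
    - rewrite (csum_ext _ (fun n => RtoC (INR H) + E n)%C) by (intros; apply Hw).
      rewrite csum_plus, csum_const. eapply Rle_trans; [apply Cmod_triangle|].
      rewrite Cmod_mult, !Cmod_R, !Rabs_pos_eq by lra. lra. }
  assert (W2 : Cmod (csum w N) <= eps * INR H * INR N).
  { apply Rsqr_incr_0_var; [|apply Rmult_le_pos; [nra|easy]].
    rewrite !Rsqr_pow2.
    apply Rle_trans with (rsum (fun n => Cmod (w n)) N ^ 2).
    - apply pow_incr; split; [apply Cmod_ge_0|apply Cmod_csum].
    - eapply Rle_trans; [apply rsum_cauchy_schwarz|].
      apply Rle_trans with (INR N * (2 * INR H * INR N)).
      + apply Rmult_le_compat_l; easy.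
      + replace ((eps * INR H * INR N) ^ 2) with
          (INR N * ((eps ^ 2 * INR H) * INR H * INR N)) by ring.
        apply Rmult_le_compat_l; [easy|]. apply Rmult_le_compat_r; [easy|].
        apply Rmult_le_compat_r; lra. }
  (* Undoing the averaging: each of the [H] shifted sums is within [2 H] of [csum z N]. Division by
     [H] leaves the boundary constant [2 H]. *)
  assert (D : Cmod (csum w N - RtoC (INR H) * csum z N) <= INR H * (2 * INR H)).
  { unfold w. rewrite csum_swap.
    replace (csum _ H - _)%C with
      (csum (fun h => csum (fun n => z (n + h)%nat) N - csum z N)%C H).
    - eapply Rle_trans; [apply Cmod_csum|].
      rewrite <- rsum_const. apply rsum_le; intros h Hh.
      eapply Rle_trans; [apply csum_shift_bound|].
      + intros; rewrite U; lra.
      + apply lt_INR in Hh; lra.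
    - unfold Cminus; rewrite csum_plus, csum_const; ring. }
  apply Rmult_le_reg_l with (INR H); [easy|].
  replace (INR H * Cmod (csum z N)) with (Cmod (RtoC (INR H) * csum z N)%C)
    by (rewrite Cmod_mult, Cmod_R, Rabs_pos_eq; lra).
  replace (RtoC (INR H) * csum z N)%C with
    (csum w N + - (csum w N - RtoC (INR H) * csum z N))%C by ring.
  eapply Rle_trans; [apply Cmod_triangle|]. rewrite Cmod_opp. lra.
Qed.

(** * Unit complex numbers and slowly varying phases *)

(** Cesaro: the terms before [n0] contribute a constant, the later ones at most [eps] each. *)
Lemma mean_zero_vanishing (r : nat -> C) :
  (forall eps, 0 < eps -> exists n0, forall n, (n0 <= n)%nat -> Cmod (r n) <= eps) ->
  mean_zero r.
Proof.
  intros H. apply mean_zero_of_affine_bound; intros eps He.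
  destruct (H eps He) as [n0 Hn].
  exists (Cmod (csum r n0)), n0; intros N HN.
  replace N with (n0 + (N - n0))%nat by lia.
  generalize (N - n0)%nat; clear N HN; intros k.
  induction k as [|k IH].
  - rewrite Nat.add_0_r. assert (0 <= eps * INR n0) by (apply Rmult_le_pos; [lra|apply pos_INR]). lra.
  - rewrite Nat.add_succ_r, S_INR; simpl.
    eapply Rle_trans; [apply Cmod_triangle|].
    specialize (Hn (n0 + k)%nat ltac:(lia)). lra.
Qed.

Lemma mean_zero_telescope (A : nat -> C) :
  (forall eps, 0 < eps -> exists n0, forall n, (n0 <= n)%nat -> Cmod (A n) <= eps * INR n) ->
  mean_zero (fun n => A (S n) - A n)%C.
Proof.
  intros H. apply mean_zero_of_affine_bound; intros eps He.
  destruct (H eps He) as [n0 Hn].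
  exists (Cmod (A O)), n0; intros N HN.
  rewrite csum_telescope. unfold Cminus. eapply Rle_trans; [apply Cmod_triangle|].
  rewrite Cmod_opp. specialize (Hn N HN). lra.
Qed.

Definition cis (x : R) : C := (cos x, sin x).

Lemma cis_plus x y : cis (x + y) = (cis x * cis y)%C.
Proof.
  unfold cis, Cmult; simpl. rewrite cos_plus, sin_plus. f_equal; ring.
Qed.

Lemma cis_0 : cis 0 = 1%C.
Proof. unfold cis; rewrite cos_0, sin_0; reflexivity. Qed.

Lemma cis_opp x : cis (- x) = Cconj (cis x).
Proof. unfold cis, Cconj; simpl. rewrite cos_neg, sin_neg; reflexivity. Qed.

Lemma Cmod_cis x : Cmod (cis x) = 1.
Proof.
  unfold Cmod, cis; simpl fst; simpl snd.
  replace (cos x ^ 2 + sin x ^ 2) with 1; [apply sqrt_1|].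
  pose proof (sin2_cos2 x) as H; unfold Rsqr in H; lra.
Qed.

Lemma Cmod_cis_sub1 x : Cmod (cis x - 1)%C = 2 * Rabs (sin (x / 2)).
Proof.
  assert (E : cos x = 1 - 2 * sin (x / 2) * sin (x / 2)).
  { rewrite <- cos_2a_sin; f_equal; field. }
  rewrite <- (Rabs_pos_eq 2) at 1 by lra. rewrite <- Rabs_mult.
  rewrite <- sqrt_Rsqr_abs. unfold Cmod, cis, Cminus, Cplus, Copp, RtoC; simpl fst; simpl snd.
  f_equal. pose proof (sin2_cos2 x) as H; unfold Rsqr in *. nra.
Qed.

Lemma Rabs_sin_le x : Rabs (sin x) <= Rabs x.
Proof.
  assert (P : forall y, 0 < y -> Rabs (sin y) <= y).
  { intros y Hy. destruct (Rle_dec y 1) as [H|H].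
    - rewrite Rabs_pos_eq.
      + left; apply sin_lt_x; easy.
      + left; apply sin_gt_0; [easy|]. pose proof PI2_1. lra.
    - pose proof (SIN_bound y). apply Rabs_le; lra. }
  destruct (Rtotal_order x 0) as [H|[->|H]].
  - rewrite <- (Rabs_Ropp x), <- (Rabs_Ropp (sin x)), <- sin_neg.
    rewrite (Rabs_pos_eq (- x)) by lra. apply P; lra.
  - rewrite sin_0; lra.
  - rewrite (Rabs_pos_eq x) by lra. apply P; lra.
Qed.

Lemma sin_ge_half x : 0 <= x <= 1 -> x / 2 <= sin x.
Proof.
  intros [[H0|<-] H1]; [|rewrite sin_0; lra].
  destruct (MVT_cor2 sin cos 0 x H0) as (y & E & Hy).
  { intros; apply derivable_pt_lim_sin. }
  rewrite sin_0 in E.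
  assert (1 / 2 <= cos y).
  { rewrite <- cos_PI3. pose proof PI2_3_2. apply cos_decr_1; lra. }
  nra.
Qed.

Lemma Cmod_cis_sub_le x y : Cmod (cis x - cis y)%C <= Rabs (x - y).
Proof.
  replace (cis x - cis y)%C with (cis y * (cis (x - y) - 1))%C.
  - rewrite Cmod_mult, Cmod_cis, Cmod_cis_sub1.
    pose proof (Rabs_sin_le ((x - y) / 2)) as H.
    unfold Rdiv in H at 2. rewrite Rabs_mult, (Rabs_pos_eq (/ 2)) in H by lra. lra.
  - replace (cis x) with (cis (y + (x - y))) by (f_equal; ring).
    rewrite cis_plus; ring.
Qed.

Lemma Cmod_cis_sub1_ge x : Rabs x <= 1 -> Rabs x / 2 <= Cmod (cis x - 1)%C.
Proof.
  intros H. rewrite Cmod_cis_sub1.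
  assert (E : Rabs (sin (x / 2)) = Rabs (sin (Rabs x / 2))).
  { unfold Rabs at 3. destruct (Rcase_abs x); [|easy].
    replace (- x / 2) with (- (x / 2)) by field.
    rewrite sin_neg, Rabs_Ropp; easy. }
  pose proof (Rabs_pos x).
  rewrite E. pose proof (sin_ge_half (Rabs x / 2) ltac:(lra)).
  pose proof (Rle_abs (sin (Rabs x / 2))). lra.
Qed.

(* Summation by parts: with [q n = 1 / (cis (D n) - 1)] one has
   [cis (f n) = q n * (cis (f (n+1)) - cis (f n))]. *)
Lemma mean_zero_slow_phase (f : nat -> R) (D := fun n => f (S n) - f n) :
  (exists n0, forall n, (n0 <= n)%nat -> Rabs (D n) <= 1) ->
  (forall eps, 0 < eps -> exists n0, forall n, (n0 <= n)%nat ->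
     1 <= eps * (INR n * Rabs (D n))) ->
  (forall eps, 0 < eps -> exists n0, forall n, (n0 <= n)%nat ->
     Rabs (D (S n) - D n) <= eps * (Rabs (D n) * Rabs (D (S n)))) ->
  mean_zero (fun n => cis (f n)).
Proof.
  intros [n0 H1] H2 H3.
  destruct (H2 1 Rlt_0_1) as [n1 H2'].
  set (n2 := max n0 n1).
  assert (HD : forall n, (n2 <= n)%nat -> 0 < Rabs (D n)).
  { intros n Hn. specialize (H2' n ltac:(unfold n2 in Hn; lia)).
    destruct (Rabs_pos (D n)) as [L|L]; [easy|]. rewrite <- L in H2'; lra. }
  set (q := fun n => (/ (cis (D n) - 1))%C).
  assert (Hge : forall n, (n2 <= n)%nat -> Rabs (D n) / 2 <= Cmod (cis (D n) - 1)%C).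
  { intros n Hn. apply Cmod_cis_sub1_ge, H1. unfold n2 in Hn; lia. }
  assert (Hnz : forall n, (n2 <= n)%nat -> (cis (D n) - 1)%C <> 0%C).
  { intros n Hn E. specialize (Hge n Hn). specialize (HD n Hn).
    rewrite E, Cmod_0 in Hge; lra. }
  assert (Hq : forall n, (n2 <= n)%nat -> Cmod (q n) <= 2 / Rabs (D n)).
  { intros n Hn. unfold q. rewrite Cmod_inv by auto.
    specialize (Hge n Hn). specialize (HD n Hn).
    replace (2 / Rabs (D n)) with (/ (Rabs (D n) / 2)) by (field; lra).
    apply Rinv_le_contravar; lra. }
  (* A difference of reciprocals is the chord between the two [cis] values times both reciprocals;
     each [q] is at most [2 / |D|], hence the 4. *)
  assert (Hq' : forall n, (n2 <= n)%nat ->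
    Cmod (q n - q (S n))%C * (Rabs (D n) * Rabs (D (S n))) <= 4 * Rabs (D (S n) - D n)).
  { intros n Hn.
    replace (q n - q (S n))%C with (q n * q (S n) * (cis (D (S n)) - cis (D n)))%C.
    2:{ unfold q; field. split; apply Hnz; lia. }
    pose proof (Hq n Hn) as Qa. pose proof (Hq (S n) ltac:(lia)) as Qb.
    pose proof (HD n Hn) as Da. pose proof (HD (S n) ltac:(lia)) as Db.
    pose proof (Cmod_cis_sub_le (D (S n)) (D n)) as L.
    rewrite !Cmod_mult.
    assert (Ba : Cmod (q n) * Rabs (D n) <= 2).
    { apply Rmult_le_compat_r with (r := Rabs (D n)) in Qa; [|lra].
      replace (2 / Rabs (D n) * Rabs (D n)) with 2 in Qa by (field; lra). easy. }
    assert (Bb : Cmod (q (S n)) * Rabs (D (S n)) <= 2).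
    { apply Rmult_le_compat_r with (r := Rabs (D (S n))) in Qb; [|lra].
      replace (2 / Rabs (D (S n)) * Rabs (D (S n))) with 2 in Qb by (field; lra). easy. }
    replace (_ * _ * _ * _) with
      ((Cmod (q n) * Rabs (D n)) * (Cmod (q (S n)) * Rabs (D (S n)))
       * Cmod (cis (D (S n)) - cis (D n))%C) by ring.
    replace (4 * Rabs (D (S n) - D n)) with (2 * 2 * Rabs (D (S n) - D n)) by ring.
    pose proof (Cmod_ge_0 (q n)). pose proof (Cmod_ge_0 (q (S n))).
    apply Rmult_le_compat; [|apply Cmod_ge_0| |easy].
    - repeat apply Rmult_le_pos; lra.
    - apply Rmult_le_compat; try easy; apply Rmult_le_pos; lra. }
  (* Abel summation: [cis (f n)] splits into a telescoping part, small because
     [|A n| <= 2 / |D n| = o(n)], and a part weighted by the increments of [q]. *)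
  set (A := fun n => (q n * cis (f n))%C).
  apply mean_zero_eventually with
    (n0 := n2) (w := fun n => ((A (S n) - A n) + (q n - q (S n)) * cis (f (S n)))%C).
  { intros n Hn. unfold A.
    replace (cis (f (S n))) with (cis (f n) * cis (D n))%C.
    2:{ rewrite <- cis_plus. f_equal. unfold D; ring. }
    replace (cis (f n)) with (cis (f n) * (q n * (cis (D n) - 1)))%C at 1.
    2:{ unfold q. rewrite Cinv_l by auto. ring. }
    ring. }
  apply mean_zero_plus; [apply mean_zero_telescope|apply mean_zero_vanishing]; intros eps He.
  - destruct (H2 (eps / 2)) as [n3 Hn3]; [lra|].
    exists (max n2 n3); intros n Hn.
    specialize (Hn3 n ltac:(lia)). specialize (HD n ltac:(lia)).
    unfold A. rewrite Cmod_mult, Cmod_cis, Rmult_1_r.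
    eapply Rle_trans; [apply Hq; lia|].
    apply Rmult_le_reg_r with (Rabs (D n)); [easy|].
    replace (2 / Rabs (D n) * Rabs (D n)) with 2 by (field; lra). lra.
  (* The third hypothesis says that the increments of [1 / D] tend to 0, and [Hq'] transfers this to
     [q]. *)
  - destruct (H3 (eps / 4)) as [n3 Hn3]; [lra|].
    exists (max n2 n3); intros n Hn.
    specialize (Hn3 n ltac:(lia)). specialize (Hq' n ltac:(lia)).
    pose proof (HD n ltac:(lia)). pose proof (HD (S n) ltac:(lia)).
    rewrite Cmod_mult, Cmod_cis, Rmult_1_r.
    apply Rmult_le_reg_r with (Rabs (D n) * Rabs (D (S n))); [nra|]. lra.
Qed.

(** * Linear combinations of shifted powers *)

Definition lsum (F : R * R -> R) (L : list (R * R)) : R :=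
  fold_right (fun p r => F p + r) 0 L.

Lemma lsum_cons F p L : lsum F (p :: L) = F p + lsum F L.
Proof. reflexivity. Qed.

Lemma lsum_ext (F G : R * R -> R) L :
  (forall p, In p L -> F p = G p) -> lsum F L = lsum G L.
Proof.
  induction L as [|p L IH]; intros H; simpl; [easy|].
  rewrite H by (left; easy). rewrite IH; [easy|]. intros; apply H; right; easy.
Qed.

Lemma lsum_mult (a : R) F L : lsum (fun p => a * F p) L = a * lsum F L.
Proof. induction L as [|p L IH]; simpl; [ring|]. rewrite IH; ring. Qed.

Lemma lsum_minus F G L : lsum (fun p => F p - G p) L = lsum F L - lsum G L.
Proof. induction L as [|p L IH]; simpl; [ring|]. rewrite IH; ring. Qed.

Lemma lsum_map F (g : R * R -> R * R) L : lsum F (map g L) = lsum (fun p => F (g p)) L.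
Proof. induction L as [|p L IH]; simpl; [easy|]. rewrite IH; easy. Qed.

Lemma lsum_app F L L' : lsum F (L ++ L') = lsum F L + lsum F L'.
Proof. induction L as [|p L IH]; simpl; [ring|]. rewrite IH; ring. Qed.

(* A list of pairs [(a, t)] encodes the function [x |-> sum a (x + t)^s]. *)
Definition psum (L : list (R * R)) (s x : R) : R :=
  lsum (fun p => fst p * Rpower (x + snd p) s) L.

Definition moment (L : list (R * R)) (d : nat) : R :=
  lsum (fun p => fst p * snd p ^ d) L.

(** Keeps every base [x + t] with [x > 0], and every [1 + t u] with [u >= 0], positive, where
    [Rpower] is the true power. *)
Definition nonneg_shifts (L : list (R * R)) : Prop :=
  Forall (fun p => 0 <= snd p) L.

(* [psum L s x = x^s * phi L s (1/x)] *)
Definition phi (L : list (R * R)) (s u : R) : R :=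
  lsum (fun p => fst p * Rpower (1 + snd p * u) s) L.

(** The effect of [d/du] on the weights in [phi]: the chain rule brings out a factor [t], which
    turns the moment of order [d] into that of order [d + 1]. *)
Definition twist (L : list (R * R)) : list (R * R) :=
  map (fun p => (fst p * snd p, snd p)) L.

(** The generalized binomial coefficient [s (s-1) ... (s-d+1) / d!], unfolded from the top factor
    because differentiation replaces [s] by [s - 1]. *)
Fixpoint gbinom (s : R) (d : nat) : R :=
  match d with O => 1 | S d' => s / INR (S d') * gbinom (s - 1) d' end.

Lemma gbinom_neq0 d s : (forall z : Z, s <> IZR z) -> gbinom s d <> 0.
Proof.
  revert s; induction d as [|d IH]; intros s Hs; [simpl; lra|].
  change (s / INR (S d) * gbinom (s - 1) d <> 0).
  assert (0 < INR (S d)) by (apply lt_0_INR; lia).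
  apply Rmult_integral_contrapositive_currified.
  - apply Rmult_integral_contrapositive_currified; [apply (Hs 0%Z)|].
    apply Rinv_neq_0_compat; lra.
  - apply IH; intros z E. apply (Hs (z + 1)%Z). rewrite plus_IZR; lra.
Qed.

Lemma moment_twist L d : moment (twist L) d = moment L (S d).
Proof.
  unfold moment, twist. rewrite lsum_map. apply lsum_ext; intros [a t] _; simpl; ring.
Qed.

Lemma nonneg_shifts_map g L :
  (forall p, 0 <= snd p -> 0 <= snd (g p)) -> nonneg_shifts L -> nonneg_shifts (map g L).
Proof.
  intros Hg HL. apply Forall_map. eapply Forall_impl; [|apply HL]. easy.
Qed.

Lemma phi_derivable L s u :
  nonneg_shifts L -> 0 <= u ->
  derivable_pt_lim (phi L s) u (s * phi (twist L) (s - 1) u).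
Proof.
  intros HL Hu. induction HL as [|[a t] L Ht HL IH].
  - replace (s * phi _ _ _) with 0 by (unfold phi; simpl; ring).
    apply (derivable_pt_lim_const 0).
  - replace (s * phi _ _ _) with
      (a * ((s * Rpower (1 + t * u) (s - 1)) * t) + s * phi (twist L) (s - 1) u)
      by (unfold phi, twist, lsum; simpl; ring).
    simpl in Ht. apply (derivable_pt_lim_plus (fun u => a * Rpower (1 + t * u) s) (phi L s)); [|apply IH].
    apply (derivable_pt_lim_scal (fun u => Rpower (1 + t * u) s)).
    apply (derivable_pt_lim_comp (fun u => 1 + t * u) (fun x => Rpower x s)).
    + assert (H : derivable_pt_lim (fun u => 1 + t * u) u (0 + t * 1)).
      { apply (derivable_pt_lim_plus (fun _ => 1) (fun u => t * u));
          [apply derivable_pt_lim_const|].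
        apply (derivable_pt_lim_scal (fun x => x)), derivable_pt_lim_id. }
      rewrite Rplus_0_l, Rmult_1_r in H; exact H.
    + apply derivable_pt_lim_power. nra.
Qed.

Lemma phi_0 L s : phi L s 0 = moment L 0.
Proof.
  apply lsum_ext; intros [a t] _; simpl.
  rewrite Rmult_0_r, Rplus_0_r. unfold Rpower. rewrite ln_1, Rmult_0_r, exp_0. easy.
Qed.

(** Taylor's formula at 0 with remainder [o(u^d)]: the coefficient of [u^i] is
    [gbinom s i * moment L i], which vanishes for [i < d]. The induction on [d] integrates the
    expansion of the derivative, hence the quantification over [L] and [s]. *)
Lemma phi_expansion d : forall L s eps,
  nonneg_shifts L -> (forall i, (i < d)%nat -> moment L i = 0) -> 0 < eps ->
  exists delta, 0 < delta /\ forall u, 0 <= u <= delta ->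
    Rabs (phi L s u - gbinom s d * moment L d * u ^ d) <= eps * u ^ d.
Proof.
  induction d as [|d IH]; intros L s eps HL HM He.
  - pose proof (phi_derivable L s 0 HL (Rle_refl 0)) as HD.
    set (l := s * _) in HD. destruct (HD 1 Rlt_0_1) as [[de Hde] Hd]. simpl in Hd.
    pose proof (Rabs_pos l) as Pl.
    assert (P0 : 0 < eps / (Rabs l + 1)) by (apply Rdiv_lt_0_compat; lra).
    (* The derivative's definition requires a strict inequality, hence [de / 2]; the other bound
       gives [(Rabs l + 1) * u <= eps]. *)
    exists (Rmin (de / 2) (eps / (Rabs l + 1))); split; [apply Rmin_pos; lra|].
    intros u [[U0|<-] U1].
    2:{ rewrite phi_0; simpl. rewrite Rmult_1_r, Rmult_1_l, Rmult_1_r.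
        unfold Rminus; rewrite Rplus_opp_r, Rabs_R0; lra. }
    assert (U2 : u <= de / 2) by (eapply Rle_trans; [apply U1|apply Rmin_l]).
    assert (U3 : u <= eps / (Rabs l + 1)) by (eapply Rle_trans; [apply U1|apply Rmin_r]).
    specialize (Hd u ltac:(lra)). rewrite (Rabs_pos_eq u) in Hd by lra.
    specialize (Hd ltac:(lra)). rewrite Rplus_0_l, phi_0 in Hd.
    simpl. rewrite Rmult_1_r, Rmult_1_l, Rmult_1_r.
    set (q := (phi L s u - moment L 0) / u) in Hd.
    replace (phi L s u - moment L 0) with (q * u) by (unfold q; field; lra).
    rewrite Rabs_mult, (Rabs_pos_eq u) by lra.
    assert (Rabs q <= Rabs l + 1).
    { replace q with ((q - l) + l) by ring. eapply Rle_trans; [apply Rabs_triang|]. lra. }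
    apply Rle_trans with ((Rabs l + 1) * (eps / (Rabs l + 1))).
    + apply Rmult_le_compat; try easy; [apply Rabs_pos|lra].
    + right; field; lra.
  - pose proof (Rabs_pos s) as Ps.
    destruct (IH (twist L) (s - 1) (eps / (Rabs s + 1))) as (de & Hde & Hd).
    { apply nonneg_shifts_map; easy. }
    { intros i Hi; rewrite moment_twist; apply HM; lia. }
    { apply Rdiv_lt_0_compat; lra. }
    exists de; split; [easy|]. intros u [[U0|<-] U1].
    2:{ rewrite phi_0, HM by lia. rewrite pow_i by lia.
        rewrite !Rmult_0_r, Rminus_0_r, Rabs_R0; lra. }
    rewrite moment_twist in Hd.
    set (M := moment L (S d)) in *.
    assert (Hn : 0 < INR (S d)) by (apply lt_0_INR; lia).
    (* The remainder vanishes at 0, and its derivative is [s] times the remainder of order [d] for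
       [twist L]. The mean value theorem supplies the missing factor [u]. *)
    set (psi := fun u => phi L s u - gbinom s (S d) * M * u ^ S d).
    set (dpsi := fun u => s * (phi (twist L) (s - 1) u - gbinom (s - 1) d * M * u ^ d)).
    destruct (MVT_cor2 psi dpsi 0 u U0) as (y & E & Hy).
    { intros y Hy. unfold dpsi.
      replace (s * (_ - _)) with (s * phi (twist L) (s - 1) y
         - gbinom s (S d) * M * (INR (S d) * y ^ pred (S d))).
      - apply derivable_pt_lim_minus; [apply phi_derivable; [easy|lra]|].
        apply (derivable_pt_lim_scal (fun u => u ^ S d)).
        apply derivable_pt_lim_pow.
      - change (gbinom s (S d)) with (s / INR (S d) * gbinom (s - 1) d).
        change (pred (S d)) with d. field. lra. }
    assert (E0 : psi 0 = 0).
    { unfold psi. rewrite phi_0, HM by lia. rewrite pow_i by lia. ring. }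
    rewrite E0, !Rminus_0_r in E. fold (psi u). rewrite E.
    rewrite Rabs_mult, (Rabs_pos_eq u) by lra.
    change (u ^ S d) with (u * u ^ d).
    replace (eps * (u * u ^ d)) with (eps * u ^ d * u) by ring.
    apply Rmult_le_compat_r; [lra|].
    unfold dpsi. rewrite Rabs_mult.
    specialize (Hd y ltac:(lra)).
    assert (Hyu : 0 <= y ^ d <= u ^ d).
    { split; [apply pow_le; lra|apply pow_incr; lra]. }
    apply Rle_trans with ((Rabs s + 1) * (eps / (Rabs s + 1) * u ^ d)).
    + apply Rmult_le_compat; [easy|apply Rabs_pos|lra|].
      eapply Rle_trans; [apply Hd|]. apply Rmult_le_compat_l; [|easy].
      left; apply Rdiv_lt_0_compat; lra.
    + right; field; lra.
Qed.

Lemma psum_phi L s x :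
  nonneg_shifts L -> 0 < x -> psum L s x = Rpower x s * phi L s (/ x).
Proof.
  intros HL Hx. unfold psum, phi. rewrite <- lsum_mult.
  apply lsum_ext; intros [a t] Hin.
  assert (0 <= t) by (eapply Forall_forall in HL; [|apply Hin]; easy).
  assert (0 < / x) by (apply Rinv_0_lt_compat; easy). simpl.
  replace (x + t) with (x * (1 + t * / x)) by (field; lra).
  rewrite <- Rpower_mult_distr; [ring|easy|nra].
Qed.

(** The expansion at [u = 1/x] with error [|G| / 2] leaves between [1/2] and [3/2] of the main term;
    2 is a rounder upper constant. *)
Lemma psum_asymptotic L s d (G := gbinom s d * moment L d) :
  nonneg_shifts L -> (forall i, (i < d)%nat -> moment L i = 0) -> G <> 0 ->
  exists x0, 0 < x0 /\ forall x, x0 <= x ->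
    Rabs G / 2 * Rpower x (s - INR d) <= Rabs (psum L s x)
      <= 2 * Rabs G * Rpower x (s - INR d).
Proof.
  intros HL HM HG. assert (PG : 0 < Rabs G) by (apply Rabs_pos_lt; easy).
  destruct (phi_expansion d L s (Rabs G / 2) HL HM) as (de & Hde & Hd); [lra|].
  exists (/ de); split; [apply Rinv_0_lt_compat; easy|]. intros x Hx.
  assert (X0 : 0 < x).
  { eapply Rlt_le_trans; [|apply Hx]. apply Rinv_0_lt_compat; easy. }
  assert (X1 : 0 < / x) by (apply Rinv_0_lt_compat; easy).
  assert (X2 : / x <= de).
  { rewrite <- (Rinv_inv de). apply Rinv_le_contravar; [apply Rinv_0_lt_compat|]; easy. }
  specialize (Hd (/ x) ltac:(lra)). fold G in Hd.
  rewrite psum_phi by easy.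
  assert (PX : 0 < Rpower x s) by apply exp_pos.
  assert (PD : 0 < (/ x) ^ d) by (apply pow_lt; easy).
  rewrite Rabs_mult, (Rabs_pos_eq (Rpower x s)) by lra.
  assert (E : Rpower x (s - INR d) = Rpower x s * (/ x) ^ d).
  { unfold Rminus. rewrite Rpower_plus, Rpower_Ropp, Rpower_pow by easy.
    rewrite pow_inv; easy. }
  rewrite E.
  set (v := phi L s (/ x)) in *. set (w := (/ x) ^ d) in *.
  assert (Rabs (G * w) = Rabs G * w) by (rewrite Rabs_mult, (Rabs_pos_eq w); lra).
  assert (Rabs v <= Rabs (v - G * w) + Rabs (G * w)).
  { replace v with ((v - G * w) + G * w) at 1 by ring. apply Rabs_triang. }
  assert (Rabs (G * w) <= Rabs (v - G * w) + Rabs v).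
  { rewrite <- (Rabs_Ropp (v - G * w)).
    replace (G * w) with (- (v - G * w) + v) at 1 by ring. apply Rabs_triang. }
  split.
  - replace (Rabs G / 2 * (Rpower x s * w)) with (Rpower x s * (Rabs G / 2 * w)) by ring.
    apply Rmult_le_compat_l; lra.
  - replace (2 * Rabs G * (Rpower x s * w)) with (Rpower x s * (2 * (Rabs G * w))) by ring.
    apply Rmult_le_compat_l; [lra|]. assert (0 <= Rabs G * w) by (apply Rmult_le_pos; lra). lra.
Qed.

(** * Finite differences and their moments *)

Definition shift (h : R) (L : list (R * R)) : list (R * R) :=
  map (fun p => (fst p, snd p + h)) L.

(** The forward difference. Its shifts may repeat, so arguments that iterate it rely on moments and
    not on distinct shifts. *)
Definition delta (h : R) (L : list (R * R)) : list (R * R) :=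
  shift h L ++ map (fun p => (- fst p, snd p)) L.

Lemma psum_delta h L s x : psum (delta h L) s x = psum L s (x + h) - psum L s x.
Proof.
  unfold psum, delta, shift. rewrite lsum_app, !lsum_map.
  unfold Rminus; f_equal.
  - apply lsum_ext; intros [a t] _; simpl. do 2 f_equal; ring.
  - replace (- lsum _ L) with (-1 * lsum (fun p => fst p * Rpower (x + snd p) s) L) by ring.
    rewrite <- lsum_mult. apply lsum_ext; intros [a t] _; simpl; ring.
Qed.

Lemma nonneg_shifts_delta h L : 0 <= h -> nonneg_shifts L -> nonneg_shifts (delta h L).
Proof.
  intros Hh HL. apply Forall_app; split; apply nonneg_shifts_map; simpl; intros; try easy; lra.
Qed.

Lemma moment_shift h L d :
  moment (shift h L) d =
  sum_f_R0 (fun i => Binomial.C d i * moment L i * h ^ (d - i)) d.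
Proof.
  unfold moment, shift. rewrite lsum_map. induction L as [|[a t] L IH].
  - simpl. rewrite sum_eq_R0; [easy|]. intros; ring.
  - rewrite lsum_cons, IH. cbn [fst snd].
    rewrite binomial, scal_sum, <- sum_plus. apply sum_eq; intros i _.
    rewrite lsum_cons. cbn [fst snd]. ring.
Qed.

Lemma sum_f_R0_last (f : nat -> R) n :
  (forall i, (i < n)%nat -> f i = 0) -> sum_f_R0 f n = f n.
Proof.
  intros H. destruct n as [|n]; [easy|]. simpl.
  rewrite sum_eq_R0; [ring|]. intros; apply H; lia.
Qed.

Lemma moment_delta h L d :
  moment (delta h L) d = moment (shift h L) d - moment L d.
Proof.
  unfold moment, delta. rewrite lsum_app, (lsum_map _ _ L). unfold Rminus; f_equal.
  replace (- lsum _ L) with (-1 * lsum (fun p => fst p * snd p ^ d) L) by ring.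
  rewrite <- lsum_mult. apply lsum_ext; intros [a t] _; simpl; ring.
Qed.

(** [(t + h)^i - t^i] has degree below [i] in [t], so only moments of order below [i <= d] occur. *)
Lemma moment_delta_low h L d :
  (forall i, (i < d)%nat -> moment L i = 0) ->
  forall i, (i < S d)%nat -> moment (delta h L) i = 0.
Proof.
  intros HM i Hi. rewrite moment_delta, moment_shift, sum_f_R0_last.
  - rewrite Nat.sub_diag, pascal_step1 by lia. rewrite Nat.sub_diag.
    unfold Binomial.C. rewrite Nat.sub_0_r. simpl. field. apply INR_fact_neq_0.
  - intros j Hj. rewrite HM by lia. ring.
Qed.

(** The only surviving term comes from the coefficient [(d + 1) h] of [t^d] in
    [(t + h)^(d+1) - t^(d+1)]. *)
Lemma moment_delta_next h L d :
  (forall i, (i < d)%nat -> moment L i = 0) ->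
  moment (delta h L) (S d) = INR (S d) * h * moment L d.
Proof.
  intros HM. rewrite moment_delta, moment_shift. cbn [sum_f_R0].
  rewrite sum_f_R0_last by (intros j Hj; rewrite HM by lia; ring).
  rewrite Nat.sub_diag. replace (S d - d)%nat with 1%nat by lia.
  unfold Binomial.C. rewrite Nat.sub_diag. replace (S d - d)%nat with 1%nat by lia.
  rewrite fact_simpl, mult_INR. simpl fact. simpl pow.
  replace (INR 1) with 1 by easy.
  assert (INR (S d) <> 0) by (apply not_0_INR; lia).
  field. split; [apply INR_fact_neq_0|easy].
Qed.

Lemma Rpower_antitone e x y : e <= 0 -> 0 < x <= y -> Rpower y e <= Rpower x e.
Proof.
  intros He Hx. replace e with (- - e) by ring. rewrite !(Rpower_Ropp _ (- e)).
  apply Rinv_le_contravar; [apply exp_pos|]. apply Rle_Rpower_l; lra.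
Qed.

Lemma Rpower_neg_vanishes a eps :
  0 < a -> 0 < eps -> exists n0, (1 <= n0)%nat /\
    forall n, (n0 <= n)%nat -> Rpower (INR n) (- a) <= eps.
Proof.
  (* The solution of [x0^(-a) = eps]. *)
  intros Ha He. set (x0 := Rpower eps (- / a)).
  assert (P0 : 0 < x0) by apply exp_pos.
  destruct (INR_unbounded x0) as [n0 Hn]. exists (S n0); split; [lia|].
  intros n Hn0. specialize (Hn n ltac:(lia)).
  apply Rle_trans with (Rpower x0 (- a)).
  - apply Rpower_antitone; lra.
  - unfold x0. rewrite Rpower_mult. replace (- / a * - a) with 1 by (field; lra).
    rewrite Rpower_1; lra.
Qed.

(** With [al = c - d] in [(0, 1)], the first difference [D] has exact order [n^(al-1)] and the
    second is [O(n^(al-2))]. Hence [D] tends to 0, [n |D|] grows like [n^al], and the second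
    difference divided by [D^2] is [O(n^(-al))]: the three conditions of [mean_zero_slow_phase]. *)
Lemma mean_zero_psum_sublinear L c d :
  (forall z : Z, c <> IZR z) -> nonneg_shifts L ->
  (forall i, (i < d)%nat -> moment L i = 0) -> moment L d <> 0 ->
  INR d < c < INR d + 1 ->
  mean_zero (fun n => cis (psum L c (INR n))).
Proof.
  intros Hc HL HM HMd Hcd.
  set (L1 := delta 1 L). set (L2 := delta 1 L1).
  assert (N1 : nonneg_shifts L1) by (apply nonneg_shifts_delta; [lra|easy]).
  assert (N2 : nonneg_shifts L2) by (apply nonneg_shifts_delta; [lra|easy]).
  pose proof (moment_delta_low 1 L d HM) as HM1. fold L1 in HM1.
  pose proof (moment_delta_low 1 L1 (S d) HM1) as HM2. fold L2 in HM2.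
  assert (X1 : moment L1 (S d) <> 0).
  { unfold L1. rewrite moment_delta_next by easy.
    assert (INR (S d) <> 0) by (apply not_0_INR; lia).
    repeat apply Rmult_integral_contrapositive_currified; try easy; lra. }
  assert (X2 : moment L2 (S (S d)) <> 0).
  { unfold L2. rewrite moment_delta_next by easy.
    assert (INR (S (S d)) <> 0) by (apply not_0_INR; lia).
    repeat apply Rmult_integral_contrapositive_currified; try easy; lra. }
  destruct (psum_asymptotic L1 c (S d) N1 HM1) as (x1 & P1 & A1).
  { apply Rmult_integral_contrapositive_currified; [apply gbinom_neq0|]; easy. }
  destruct (psum_asymptotic L2 c (S (S d)) N2 HM2) as (x2 & P2 & A2).
  { apply Rmult_integral_contrapositive_currified; [apply gbinom_neq0|]; easy. }
  assert (G1 : 0 < Rabs (gbinom c (S d) * moment L1 (S d))).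
  { apply Rabs_pos_lt, Rmult_integral_contrapositive_currified; [apply gbinom_neq0|]; easy. }
  assert (G2 : 0 < Rabs (gbinom c (S (S d)) * moment L2 (S (S d)))).
  { apply Rabs_pos_lt, Rmult_integral_contrapositive_currified; [apply gbinom_neq0|]; easy. }
  set (k1 := Rabs (gbinom c (S d) * moment L1 (S d))) in *.
  set (k2 := Rabs (gbinom c (S (S d)) * moment L2 (S (S d)))) in *.
  rewrite S_INR in A1. rewrite (S_INR (S d)), S_INR in A2.
  set (al := c - INR d). assert (Hal : 0 < al < 1) by (unfold al; lra).
  replace (c - (INR d + 1)) with (al - 1) in A1 by (unfold al; ring).
  replace (c - (INR d + 1 + 1)) with (al - 2) in A2 by (unfold al; ring).
  destruct (INR_unbounded x1) as [m1 U1]. destruct (INR_unbounded x2) as [m2 U2].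
  assert (B1 : forall n, (m1 <= n)%nat ->
    k1 / 2 * Rpower (INR n) (al - 1) <= Rabs (psum L1 c (INR n))
      <= 2 * k1 * Rpower (INR n) (al - 1)) by auto.
  assert (B2 : forall n, (m2 <= n)%nat ->
    Rabs (psum L2 c (INR n)) <= 2 * k2 * Rpower (INR n) (al - 2)) by (intros; apply A2; auto).
  assert (E1 : forall n, psum L c (INR (S n)) - psum L c (INR n) = psum L1 c (INR n)).
  { intros n. unfold L1. rewrite psum_delta, S_INR. easy. }
  assert (E2 : forall n, psum L1 c (INR (S n)) - psum L1 c (INR n) = psum L2 c (INR n)).
  { intros n. unfold L2. rewrite psum_delta, S_INR. easy. }
  apply mean_zero_slow_phase.
  - destruct (Rpower_neg_vanishes (1 - al) (/ (2 * k1))) as (n0 & _ & Hn0);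
      [lra|apply Rinv_0_lt_compat; lra|].
    exists (max n0 m1); intros n Hn. rewrite E1.
    eapply Rle_trans; [apply B1; lia|]. specialize (Hn0 n ltac:(lia)).
    replace (- (1 - al)) with (al - 1) in Hn0 by ring.
    apply Rmult_le_compat_l with (r := 2 * k1) in Hn0; [|lra].
    rewrite Rinv_r in Hn0; lra.
  - intros eps He.
    assert (0 < eps * (k1 / 2)) by (apply Rmult_lt_0_compat; lra).
    destruct (Rpower_neg_vanishes al (eps * (k1 / 2))) as (n0 & Hn1 & Hn0); [lra|easy|].
    exists (max n0 m1); intros n Hn. rewrite E1.
    specialize (Hn0 n ltac:(lia)). destruct (B1 n ltac:(lia)) as [B1n _].
    assert (Pn : 0 < INR n) by (apply lt_0_INR; lia).
    assert (Pa : 0 < Rpower (INR n) al) by apply exp_pos.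
    rewrite Rpower_Ropp in Hn0.
    apply Rmult_le_compat_r with (r := Rpower (INR n) al) in Hn0; [|lra].
    rewrite Rinv_l in Hn0 by lra.
    eapply Rle_trans; [apply Hn0|]. rewrite Rmult_assoc. apply Rmult_le_compat_l; [lra|].
    apply Rmult_le_compat_l with (r := INR n) in B1n; [|lra].
    eapply Rle_trans; [|apply B1n]. right.
    replace (al) with (1 + (al - 1)) at 1 by ring. rewrite Rpower_plus, Rpower_1 by easy. ring.
  - intros eps He.
    (* Lower constant for [|D n| |D (n+1)|] in terms of [n^(2 al - 2)]; the power of 2 comes from
       [n + 1 <= 2 n]. *)
    set (k3 := (k1 / 2) * ((k1 / 2) * Rpower 2 (al - 1))).
    assert (P3 : 0 < k3).
    { unfold k3. assert (0 < Rpower 2 (al - 1)) by apply exp_pos.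
      repeat apply Rmult_lt_0_compat; lra. }
    destruct (Rpower_neg_vanishes al (eps * k3 / (2 * k2))) as (n0 & Hn1 & Hn0); [lra| |].
    { apply Rdiv_lt_0_compat; [apply Rmult_lt_0_compat|]; lra. }
    exists (max n0 (max m1 m2)); intros n Hn. rewrite !E1, E2.
    specialize (Hn0 n ltac:(lia)).
    assert (Pn : 1 <= INR n) by (apply (le_INR 1); lia).
    destruct (B1 n ltac:(lia)) as [Ba _]. destruct (B1 (S n) ltac:(lia)) as [Bb _].
    eapply Rle_trans; [apply B2; lia|].
    set (X := Rpower (INR n) (al - 1)) in *.
    assert (PX : 0 < X) by apply exp_pos.
    assert (Bc : Rpower 2 (al - 1) * X <= Rpower (INR (S n)) (al - 1)).
    { unfold X. rewrite Rpower_mult_distr by lra. apply Rpower_antitone; [lra|].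
      rewrite S_INR; lra. }
    assert (Bd : k3 * (X * X) <= Rabs (psum L1 c (INR n)) * Rabs (psum L1 c (INR (S n)))).
    { unfold k3. replace (_ * _ * (X * X)) with
        ((k1 / 2 * X) * (k1 / 2 * (Rpower 2 (al - 1) * X))) by ring.
      assert (0 < Rpower 2 (al - 1) * X) by (apply Rmult_lt_0_compat; [apply exp_pos|easy]).
      apply Rmult_le_compat; [| |easy|].
      - apply Rmult_le_pos; lra.
      - apply Rmult_le_pos; lra.
      - eapply Rle_trans; [|apply Bb]. apply Rmult_le_compat_l; lra. }
    apply Rle_trans with (eps * (k3 * (X * X))); [|apply Rmult_le_compat_l; lra].
    replace (Rpower (INR n) (al - 2)) with (Rpower (INR n) (- al) * (X * X)).
    + apply Rmult_le_compat_l with (r := 2 * k2) in Hn0; [|lra].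
      replace (2 * k2 * (eps * k3 / (2 * k2))) with (eps * k3) in Hn0 by (field; lra).
      apply Rmult_le_compat_r with (r := X * X) in Hn0; [lra|]. apply Rmult_le_pos; lra.
    + unfold X. rewrite <- !Rpower_plus. f_equal; ring.
Qed.

(** [j] counts the differencings still to be made; [d + j], the integer part of [c], is unchanged by
    each of them. *)
Lemma mean_zero_psum j : forall L c d,
  (forall z : Z, c <> IZR z) -> nonneg_shifts L ->
  (forall i, (i < d)%nat -> moment L i = 0) -> moment L d <> 0 ->
  INR (d + j) < c < INR (d + j) + 1 ->
  mean_zero (fun n => cis (psum L c (INR n))).
Proof.
  induction j as [|j IH]; intros L c d Hc HL HM HMd Hcd.
  - rewrite Nat.add_0_r in Hcd. apply (mean_zero_psum_sublinear L c d); easy.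
  - apply van_der_corput; [intros; apply Cmod_cis|].
    intros l Hl. apply mean_zero_ext with (fun n => cis (psum (delta (INR l) L) c (INR n))).
    + intros n. rewrite <- cis_opp, <- cis_plus, psum_delta, plus_INR. easy.
    + apply IH with (d := S d); [easy|apply nonneg_shifts_delta; [apply pos_INR|easy]
        |apply moment_delta_low; easy| |].
      * rewrite moment_delta_next by easy.
        assert (INR (S d) <> 0) by (apply not_0_INR; lia).
        assert (INR l <> 0) by (apply not_0_INR; lia).
        repeat apply Rmult_integral_contrapositive_currified; easy.
      * replace (S d + j)%nat with (d + S j)%nat by lia; easy.
Qed.

(* Vandermonde, by eliminating one node at a time. *)
Lemma moments_determine_coefficients n : forall L, length L = n ->
  NoDup (map snd L) -> (forall d, (d < n)%nat -> moment L d = 0) ->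
  Forall (fun p => fst p = 0) L.
Proof.
  induction n as [|n IH]; intros [|[a0 t0] L] Hn HN HM; try easy.
  simpl in Hn, HN. inversion HN as [|x l Hin HN' E]; subst x l.
  assert (F : Forall (fun p => fst p = 0) L).
  (* The weight [t - t0] kills the node [t0], and the new moment of order [d] is
     [moment (S d) - t0 * moment d], computed on the full list. *)
  { assert (F' : Forall (fun p => fst p = 0) (map (fun p => (fst p * (snd p - t0), snd p)) L)).
    { apply IH.
      - rewrite length_map; lia.
      - rewrite map_map; simpl. easy.
      - intros d Hd. unfold moment. rewrite lsum_map.
        rewrite (lsum_ext _ (fun p => fst p * snd p ^ S d - t0 * (fst p * snd p ^ d)))
          by (intros [a t] _; simpl; ring).
        rewrite lsum_minus, lsum_mult.
        pose proof (HM (S d) ltac:(lia)) as H1. pose proof (HM d ltac:(lia)) as H2.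
        unfold moment in H1, H2; rewrite lsum_cons in H1, H2; cbn [fst snd] in H1, H2.
        change (t0 ^ S d) with (t0 * t0 ^ d) in H1. nra. }
    rewrite Forall_map in F'. apply Forall_forall; intros [a t] Hp.
    eapply Forall_forall in F'; [|apply Hp]. simpl in *.
    destruct (Rmult_integral _ _ F') as [|H]; [easy|].
    exfalso; apply Hin. replace t0 with t by lra. apply (in_map snd _ _ Hp). }
  constructor; [|easy]. simpl.
  pose proof (HM O ltac:(lia)) as H0. unfold moment in H0; rewrite lsum_cons in H0.
  rewrite (lsum_ext _ (fun p => 0 * 0)), lsum_mult in H0.
  - simpl in H0; lra.
  - intros p Hp. eapply Forall_forall in F; [|apply Hp]. rewrite F; ring.
Qed.

Lemma first_nonzero_moment L n :
  (forall d, (d < n)%nat -> moment L d = 0) \/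
  exists d, (d < n)%nat /\ moment L d <> 0 /\ forall i, (i < d)%nat -> moment L i = 0.
Proof.
  induction n as [|n [IH|(d & Hd & IH)]].
  - left; intros; lia.
  - destruct (Req_dec (moment L n) 0) as [E|E].
    + left; intros d Hd. destruct (Nat.eq_dec d n) as [->|]; [easy|apply IH; lia].
    + right; exists n; repeat split; [lia|easy|easy].
  - right; exists d; split; [lia|easy].
Qed.

Lemma mean_zero_power_combination L c :
  (forall z : Z, c <> IZR z) -> nonneg_shifts L -> NoDup (map snd L) ->
  Exists (fun p => fst p <> 0) L -> INR (length L) <= c + 1 ->
  mean_zero (fun n => cis (psum L c (INR n))).
Proof.
  intros Hc HL HN HE Hk.
  destruct (first_nonzero_moment L (length L)) as [H|(d & Hd & HMd & HM)].
  { exfalso. pose proof (moments_determine_coefficients _ L eq_refl HN H) as F.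
    apply Exists_exists in HE as (p & Hp & Hnz).
    eapply Forall_forall in F; [|apply Hp]. easy. }
  (* From [d + 1 <= length L <= c + 1]; equality is excluded because [c] is not an integer. *)
  assert (Hd' : INR d < c).
  { apply (le_INR (S d)) in Hd. rewrite S_INR in Hd.
    assert (c <> INR d) by (rewrite INR_IZR_INZ; apply Hc). lra. }
  pose proof (base_Int_part c) as [I1 I2].
  set (z := Int_part c) in *.
  assert (Hz : (Z.of_nat d <= z)%Z).
  { apply Z.lt_succ_r, lt_IZR. rewrite succ_IZR, <- INR_IZR_INZ. lra. }
  assert (E : INR (d + (Z.to_nat z - d)) = IZR z).
  { rewrite INR_IZR_INZ; f_equal; lia. }
  apply mean_zero_psum with (d := d) (j := (Z.to_nat z - d)%nat); try easy.
  rewrite E. assert (c <> IZR z) by apply Hc. lra.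
Qed.

(** * Trigonometric polynomials and Weyl's criterion *)

(* [trigpoly T a]: [T] is a trigonometric polynomial of period 1 with constant
   coefficient [a]. *)
Inductive trigpoly : (R -> C) -> C -> Prop :=
| trigpoly_char f :
    trigpoly (fun y => cis (2 * PI * IZR f * y)) (if Z.eqb f 0 then RtoC 1 else RtoC 0)
| trigpoly_plus T U a b :
    trigpoly T a -> trigpoly U b -> trigpoly (fun y => T y + U y)%C (a + b)%C
| trigpoly_mult c T a : trigpoly T a -> trigpoly (fun y => c * T y)%C (c * a)%C
| trigpoly_ext T U a : (forall y, T y = U y) -> trigpoly T a -> trigpoly U a.

(** Translation multiplies each character by a constant, which is 1 at frequency 0. *)
Lemma trigpoly_translate T a s : trigpoly T a -> trigpoly (fun y => T (y - s)) a.
Proof.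
  induction 1 as [f|T U a b _ IH1 _ IH2|c T a _ IH|T U a E _ IH].
  - replace (if Z.eqb f 0 then RtoC 1 else RtoC 0) with
      (cis (2 * PI * IZR f * - s) * (if Z.eqb f 0 then RtoC 1 else RtoC 0))%C.
    + eapply trigpoly_ext; [|apply trigpoly_mult, trigpoly_char].
      intros y; simpl. rewrite <- cis_plus. f_equal; ring.
    + destruct (Z.eqb_spec f 0) as [->|_]; [|ring].
      rewrite Rmult_0_r, Rmult_0_l, cis_0; ring.
  - apply (trigpoly_plus (fun y => T (y - s)) (fun y => U (y - s))); easy.
  - apply (trigpoly_mult c (fun y => T (y - s))); easy.
  - apply trigpoly_ext with (fun y => T (y - s)); [intros; apply E|easy].
Qed.

Lemma trigpoly_csum (T : nat -> R -> C) (a : nat -> C) n :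
  (forall i, (i < n)%nat -> trigpoly (T i) (a i)) ->
  trigpoly (fun y => csum (fun i => T i y) n) (csum a n).
Proof.
  induction n as [|n IH]; intros H; simpl.
  - replace (RtoC 0) with (0 * (if Z.eqb 0 0 then RtoC 1 else RtoC 0))%C by ring.
    eapply trigpoly_ext; [|apply trigpoly_mult, trigpoly_char]. intros; simpl; ring.
  - apply (trigpoly_plus (fun y => csum (fun i => T i y) n)); auto.
Qed.

Fixpoint dot (Y : nat -> nat -> R) (j : nat) (h : list Z) (n : nat) : R :=
  match h with
  | nil => 0
  | f :: h' => IZR f * Y j n + dot Y (S j) h' n
  end.

Fixpoint tprod (T : nat -> R -> C) (Y : nat -> nat -> R) (j n : nat) : C :=
  match j with O => 1%C | S j' => (tprod T Y j' n * T j' (Y j' n))%C end.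

Definition zero_ind (h : list Z) : C := if forallb (Z.eqb 0) h then RtoC 1 else RtoC 0.

Lemma dot_zero Y h : forall j n, forallb (Z.eqb 0) h = true -> dot Y j h n = 0.
Proof.
  induction h as [|f h IH]; intros j n H; cbn [dot forallb] in *; [easy|].
  apply andb_prop in H as [H1 H2]. apply Z.eqb_eq in H1 as <-.
  rewrite IH by easy. ring.
Qed.

(** A hybrid statement: coordinates below [j] carry trigonometric polynomials, those from [j] on a
    character with frequencies [h]. It is the Weyl hypothesis at [j = 0] and the mean of the full
    product at [j = k], [h = nil]. *)
Lemma weyl_product (T : nat -> R -> C) (a : C) (Y : nat -> nat -> R) k :
  (forall h, length h = k -> Exists (fun f => f <> 0%Z) h ->
     mean_zero (fun n => cis (2 * PI * dot Y 0 h n))) ->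
  (forall j, trigpoly (T j) a) ->
  forall j h, (j + length h)%nat = k ->
  mean_zero (fun n => tprod T Y j n * cis (2 * PI * dot Y j h n) - a ^ j * zero_ind h)%C.
Proof.
  intros W HT. induction j as [|j IH]; intros h Hk.
  - unfold zero_ind. destruct (forallb (Z.eqb 0) h) eqn:E.
    + eapply mean_zero_ext; [|apply mean_zero_0]. intros n; simpl.
      rewrite dot_zero, Rmult_0_r, cis_0 by easy. ring.
    + eapply mean_zero_ext; [|apply (W h); [easy|]].
      * intros n; simpl; ring.
      * apply Exists_exists. clear -E. induction h as [|f h IH]; [easy|].
        cbn [forallb] in E. destruct (Z.eqb_spec 0 f) as [<-|Hf].
        -- destruct (IH E) as (x & Hx & Hn). exists x; split; [right|]; easy.
        -- exists f; split; [left; easy|congruence].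
  (* By linearity the factor in coordinate [j] may be a single character, whose frequency is then
     prepended to [h]. *)
  - assert (G : forall T0 b, trigpoly T0 b ->
      mean_zero (fun n => tprod T Y j n * T0 (Y j n) * cis (2 * PI * dot Y (S j) h n)
        - a ^ j * b * zero_ind h)%C).
    { induction 1 as [f|T1 T2 b1 b2 _ IH1 _ IH2|c T1 b _ IH1|T1 T2 b E _ IH1].
      - eapply mean_zero_ext; [|apply (IH (f :: h)); simpl; lia].
        intros n. cbn [dot]. unfold zero_ind; cbn [forallb].
        replace (2 * PI * (IZR f * Y j n + dot Y (S j) h n)) with
          (2 * PI * IZR f * Y j n + 2 * PI * dot Y (S j) h n) by ring.
        rewrite cis_plus, (Z.eqb_sym 0 f). destruct (Z.eqb f 0); simpl; ring.
      - eapply mean_zero_ext; [|apply (mean_zero_plus _ _ IH1 IH2)]. intros n; simpl; ring.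
      - eapply mean_zero_ext; [|apply (mean_zero_mult c _ IH1)]. intros n; simpl; ring.
      - eapply mean_zero_ext; [|apply IH1]. intros n; simpl. rewrite E; easy. }
    eapply mean_zero_ext; [|apply (G (T j) a (HT j))].
    intros n; simpl; ring.
Qed.

(** * Geometric sums and the Fejer kernel on a grid *)

Lemma csum_geometric_cis theta K :
  (csum (fun i => cis (INR i * theta)) K * (cis theta - 1) = cis (INR K * theta) - 1)%C.
Proof.
  rewrite <- csum_mult_r.
  rewrite (csum_ext _ (fun i => cis (INR (S i) * theta) - cis (INR i * theta))%C).
  - rewrite (csum_telescope (fun i => cis (INR i * theta))).
    simpl INR. rewrite Rmult_0_l, cis_0. easy.
  - intros i _. rewrite S_INR. replace ((INR i + 1) * theta) with (INR i * theta + theta) by ring.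
    rewrite cis_plus; ring.
Qed.

Lemma cis_2PI_INR n : cis (2 * PI * INR n) = 1%C.
Proof.
  unfold cis. replace (2 * PI * INR n) with (0 + 2 * INR n * PI) by ring.
  rewrite cos_period, sin_period, cos_0, sin_0. easy.
Qed.

Lemma cis_2PI_IZR z : cis (2 * PI * IZR z) = 1%C.
Proof.
  destruct (Z_le_gt_dec 0 z).
  - rewrite <- (Z2Nat.id z), <- INR_IZR_INZ by lia. apply cis_2PI_INR.
  - replace z with (- Z.of_nat (Z.to_nat (- z)))%Z by lia.
    rewrite opp_IZR, <- INR_IZR_INZ.
    replace (2 * PI * - _) with (- (2 * PI * INR (Z.to_nat (- z)))) by ring.
    rewrite cis_opp, cis_2PI_INR. unfold Cconj, RtoC; simpl. rewrite Ropp_0; easy.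
Qed.

(** The ratio [cis theta] is a [K]-th root of unity, and it differs from 1 since
    [theta / 2 = PI (b - a) / K] with [0 < |b - a| < K]. *)
Lemma root_of_unity_sum a b K :
  (a < K)%nat -> (b < K)%nat -> a <> b ->
  csum (fun i => cis (INR i * (2 * PI * (INR b - INR a) / INR K))) K = 0%C.
Proof.
  intros Ha Hb Hab.
  assert (PK : 0 < INR K) by (apply lt_0_INR; lia).
  set (theta := 2 * PI * (INR b - INR a) / INR K).
  assert (G := csum_geometric_cis theta K).
  replace (INR K * theta) with (2 * PI * IZR (Z.of_nat b - Z.of_nat a)) in G.
  2:{ rewrite minus_IZR, <- !INR_IZR_INZ. unfold theta; field; lra. }
  rewrite cis_2PI_IZR in G.
  assert (NZ : (cis theta - 1)%C <> 0%C).
  { intros E. apply (f_equal Cmod) in E. rewrite Cmod_0, Cmod_cis_sub1 in E.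
    assert (S0 : sin (theta / 2) = 0).
    { destruct (Req_dec (sin (theta / 2)) 0) as [|N]; [easy|].
      apply Rabs_pos_lt in N; lra. }
    replace (theta / 2) with (PI * ((INR b - INR a) / INR K)) in S0
      by (unfold theta; field; lra).
    pose proof PI_RGT_0. pose proof (pos_INR a). pose proof (pos_INR b).
    apply lt_INR in Ha, Hb.
    set (x := (INR b - INR a) / INR K) in S0.
    assert (Ex : x * INR K = INR b - INR a) by (unfold x; field; lra).
    assert (Hx : -1 < x < 1) by (split; nra).
    destruct (Rtotal_order x 0) as [L|[L|L]].
    - assert (sin (PI * x) < 0) by (apply sin_lt_0_var; nra). lra.
    - apply Hab, INR_eq. rewrite L in Ex; lra.
    - assert (0 < sin (PI * x)) by (apply sin_gt_0; nra). lra. }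
  set (S := csum _ K) in *.
  replace S with (S * (cis theta - 1) * / (cis theta - 1))%C by (field; easy).
  rewrite G. ring.
Qed.

Definition dirichlet (K : nat) (y : R) : C := csum (fun a => cis (INR a * (2 * PI * y))) K.

(* Normalised without the usual factor [1 / K], so its mean is [K]. *)
Definition fejer (K : nat) (y : R) : R := Cmod (dirichlet K y) ^ 2.

Lemma fejer_nonneg K y : 0 <= fejer K y.
Proof. apply pow2_ge_0. Qed.

Lemma fejer_expand K y : RtoC (fejer K y) =
  csum (fun a => csum (fun b => cis (2 * PI * (INR a - INR b) * y)) K) K.
Proof.
  unfold fejer. rewrite Cmod2_conj. unfold dirichlet.
  rewrite csum_conj, <- csum_mult_r. apply csum_ext; intros a _.
  rewrite <- csum_mult_l. apply csum_ext; intros b _.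
  rewrite <- cis_opp, <- cis_plus. f_equal; ring.
Qed.

Lemma csum_diagonal (x : C) K :
  csum (fun a => csum (fun b => if Nat.eqb a b then x else 0%C) K) K = (RtoC (INR K) * x)%C.
Proof.
  rewrite (csum_ext _ (fun _ => x)); [apply csum_const|].
  intros; apply csum_single; easy.
Qed.

Lemma trigpoly_fejer K : trigpoly (fun y => RtoC (fejer K y)) (RtoC (INR K)).
Proof.
  eapply trigpoly_ext; [intros y; symmetry; apply fejer_expand|].
  replace (RtoC (INR K)) with (RtoC (INR K) * 1)%C by ring. rewrite <- csum_diagonal.
  apply (trigpoly_csum (fun a y => csum (fun b => cis (2 * PI * (INR a - INR b) * y)) K)); intros a _.
  apply (trigpoly_csum (fun b y => cis (2 * PI * (INR a - INR b) * y))); intros b _.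
  replace (if Nat.eqb a b then RtoC 1 else 0%C) with
    (if Z.eqb (Z.of_nat a - Z.of_nat b) 0 then RtoC 1 else RtoC 0).
  - eapply trigpoly_ext; [|apply trigpoly_char].
    intros y; simpl. rewrite minus_IZR, <- !INR_IZR_INZ; easy.
  - destruct (Nat.eqb_spec a b), (Z.eqb_spec (Z.of_nat a - Z.of_nat b) 0); try easy; lia.
Qed.

(** All frequencies [a - b] are below [K] in absolute value, so summing over [K] equidistant
    translates keeps the [K] diagonal terms alone, each counted [K] times. Since the total is exact,
    an upper bound for the translates far from [y] yields a lower bound for the near ones. *)
Lemma fejer_grid_sum K y :
  (0 < K)%nat -> rsum (fun i => fejer K (y - INR i / INR K)) K = INR K * INR K.
Proof.
  intros HK. assert (PK : 0 < INR K) by (apply lt_0_INR; easy).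
  apply RtoC_inj. rewrite <- csum_RtoC.
  rewrite (csum_ext _ (fun i => csum (fun a => csum (fun b =>
     cis (2 * PI * (INR a - INR b) * (y - INR i / INR K))) K) K))
    by (intros; apply fejer_expand).
  rewrite csum_swap, RtoC_mult, <- csum_diagonal.
  apply csum_ext; intros a Ha. rewrite csum_swap. apply csum_ext; intros b Hb.
  rewrite (csum_ext _ (fun i => cis (2 * PI * (INR a - INR b) * y) *
     cis (INR i * (2 * PI * (INR b - INR a) / INR K)))%C).
  - rewrite csum_mult_l. destruct (Nat.eqb_spec a b) as [<-|Hab].
    + rewrite (csum_ext _ (fun _ => 1%C)).
      * rewrite csum_const.
        replace (2 * PI * (INR a - INR a) * y) with 0 by ring. rewrite cis_0; ring.
      * intros i _. replace (INR i * _) with 0 by (field; lra). apply cis_0.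
    + rewrite root_of_unity_sum by easy. ring.
  - intros i _. rewrite <- cis_plus. f_equal. field; lra.
Qed.

Lemma sin_PI_lower s d : 0 < d <= / 4 -> d <= s <= 1 - d -> d <= sin (PI * s).
Proof.
  intros Hd Hs. pose proof PI_4. pose proof PI2_3_2.
  assert (P : forall x, d <= x <= / 2 -> d <= sin (PI * x)).
  { intros x Hx. apply Rle_trans with (sin (PI * d)).
    - assert (PI * d / 2 <= sin (PI * d)) by (apply sin_ge_half; nra). nra.
    - apply sin_incr_1; nra. }
  destruct (Rle_dec s (/ 2)) as [L|L]; [apply P; lra|].
  replace (PI * s) with (PI - PI * (1 - s)) by ring. rewrite sin_PI_x. apply P; lra.
Qed.

(** In the geometric sum the numerator is at most 2 and the denominator at least [2 d]. The bound
    does not grow with [K], while the grid sum is [K^2]. *)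
Lemma fejer_far K y d s z :
  0 < d <= / 4 -> y = IZR z - s -> d <= s <= 1 - d -> fejer K y <= / d ^ 2.
Proof.
  intros Hd Hy Hs.
  pose proof (csum_geometric_cis (2 * PI * y) K) as G. fold (dirichlet K y) in G.
  apply (f_equal Cmod) in G. rewrite Cmod_mult in G.
  assert (N : Cmod (cis (INR K * (2 * PI * y)) - 1)%C <= 2).
  { eapply Rle_trans; [apply Cmod_triangle|]. rewrite Cmod_cis, Cmod_opp, Cmod_1; lra. }
  assert (Q : 2 * d <= Cmod (cis (2 * PI * y) - 1)%C).
  { replace (2 * PI * y) with (2 * PI * IZR z + - (2 * PI * s)) by (rewrite Hy; ring).
    rewrite cis_plus, cis_2PI_IZR, Cmult_1_l, Cmod_cis_sub1.
    replace (- (2 * PI * s) / 2) with (- (PI * s)) by field.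
    rewrite sin_neg, Rabs_Ropp. pose proof (sin_PI_lower s d Hd Hs).
    pose proof (Rle_abs (sin (PI * s))). lra. }
  rewrite <- G in N. pose proof (Cmod_ge_0 (dirichlet K y)) as P0.
  assert (B : Cmod (dirichlet K y) <= / d).
  { apply Rmult_le_reg_r with d; [easy|]. rewrite Rinv_l by lra. nra. }
  unfold fejer. rewrite <- pow_inv. apply pow_incr; easy.
Qed.

(** * Counting blocks *)

(* Average of Fejer kernels centred at the points [i / K] of a slightly enlarged
   arc, with [K = m p^4] points on the circle and a margin of [p^3] points. *)
Lemma arc_majorant (m : Z) (eps : R) : (0 < m)%Z -> 0 < eps ->
  exists (t : R -> R) (mu : R),
    trigpoly (fun y => RtoC (t y)) (RtoC mu) /\ (forall y, 0 <= t y) /\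
    (forall y z, IZR z <= y < IZR z + / IZR m -> 1 <= t y) /\
    0 <= mu <= / IZR m + eps.
Proof.
  intros Hm He.
  set (M := IZR m). assert (PM : 1 <= M) by (apply (IZR_le 1); lia).
  (* The term [6 / eps] controls the mean, 4 gives [d <= / 4] and [/ P <= / 4], and [M] controls the
     far translates in [L2]. *)
  destruct (INR_unbounded (6 / eps + 4 + M)) as [p Hp]. specialize (Hp p (le_n p)).
  set (P := INR p) in *.
  assert (P6 : 0 < 6 / eps) by (apply Rdiv_lt_0_compat; lra).
  assert (Peps : 6 <= eps * P).
  { replace 6 with (eps * (6 / eps)) by (field; lra). apply Rmult_le_compat_l; lra. }
  set (K := (Z.to_nat m * p ^ 4)%nat). set (r := (p ^ 3)%nat).
  set (A := (p ^ 4 + 2 * r)%nat).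
  assert (EK : INR K = M * P ^ 4).
  { unfold K. rewrite mult_INR, pow_INR. f_equal. unfold M.
    rewrite INR_IZR_INZ, Z2Nat.id by lia. easy. }
  assert (Er : INR r = P ^ 3) by (unfold r; rewrite pow_INR; easy).
  assert (EA : INR A = P ^ 4 + 2 * P ^ 3).
  { unfold A. rewrite plus_INR, mult_INR, pow_INR, Er. fold P. change (INR 2) with 2. ring. }
  assert (PP : 4 < P) by lra.
  assert (P3 : 0 < P ^ 3) by (apply pow_lt; lra).
  assert (P4 : 0 < P ^ 4) by (apply pow_lt; lra).
  assert (PK : 0 < INR K) by (rewrite EK; apply Rmult_lt_0_compat; lra).
  assert (HK : (0 < K)%nat) by (apply INR_lt; simpl; easy).
  (* The width [P^3 / K] of the margin on either side of the arc. *)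
  set (d := / (M * P)).
  assert (PMP : 4 <= M * P) by nra.
  assert (Hd : 0 < d <= / 4).
  { unfold d; split; [apply Rinv_0_lt_compat; lra|]. apply Rinv_le_contravar; lra. }
  (* Numbering starts [r] points before the arc, so the indices [i < A] are the points of the arc
     with both margins. *)
  set (g := fun y i => fejer K (y - (INR i - INR r) / INR K)).
  set (w := / (INR K * INR K * (1 - / P))).
  assert (HP1 : 0 < / P <= / 4).
  { split; [apply Rinv_0_lt_compat; lra|apply Rinv_le_contravar; lra]. }
  assert (PW0 : 0 < INR K * INR K * (1 - / P)) by (repeat apply Rmult_lt_0_compat; lra).
  assert (PW : 0 < w) by (apply Rinv_0_lt_compat; easy).
  exists (fun y => w * rsum (g y) A), (w * (INR A * INR K)). split; [|split; [|split]].
  - rewrite RtoC_mult, (RtoC_mult (INR A)), <- csum_const.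
    apply trigpoly_ext with (fun y => RtoC w * csum (fun i => RtoC (g y i)) A)%C.
    { intros y. rewrite csum_RtoC, RtoC_mult; easy. }
    apply trigpoly_mult.
    apply (trigpoly_csum (fun i y => RtoC (g y i)) (fun _ => RtoC (INR K))).
    intros i _. apply (trigpoly_translate (fun y => RtoC (fejer K y))), trigpoly_fejer.
  - intros y. apply Rmult_le_pos; [lra|].
    replace 0 with (rsum (fun _ => 0) A) by (rewrite rsum_const; ring).
    apply rsum_le; intros; apply fejer_nonneg.
  - intros y z Hy.
    assert (T : rsum (g y) K = INR K * INR K).
    { rewrite <- (fejer_grid_sum K (y + INR r / INR K)) by easy.
      assert (X : forall n, rsum (g y) n =
         rsum (fun i => fejer K (y + INR r / INR K - INR i / INR K)) n).
      { induction n as [|n IH]; simpl; [easy|]. rewrite IH. unfold g at 1.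
        do 2 f_equal. field; lra. }
      apply X. }
    assert (Far : forall i, (A <= i < K)%nat -> g y i <= / d ^ 2).
    { intros i [Hi1 Hi2]. apply le_INR in Hi1. apply lt_INR in Hi2. rewrite EA in Hi1.
      apply fejer_far with (s := (INR i - INR r) / INR K - (y - IZR z)) (z := z);
        [easy|ring|]. rewrite Er.
      assert (EM : / M = P ^ 4 / INR K) by (rewrite EK; field; split; lra).
      assert (Ed : d = P ^ 3 / INR K) by (rewrite EK; unfold d; field; split; lra).
      fold M in Hy. split.
      - apply Rle_trans with ((INR i - P ^ 3) / INR K - / M); [|lra].
        rewrite EM, Ed. unfold Rdiv. rewrite <- Rmult_minus_distr_r.
        apply Rmult_le_compat_r; [left; apply Rinv_0_lt_compat; easy|lra].
      - apply Rle_trans with ((INR i - P ^ 3) / INR K); [lra|].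
        replace (1 - d) with ((INR K - P ^ 3) / INR K) by (rewrite Ed; field; lra).
        apply Rmult_le_compat_r; [left; apply Rinv_0_lt_compat; easy|lra]. }
    assert (L : INR K * INR K <= rsum (g y) A + INR K * / d ^ 2).
    { rewrite <- T. assert (D2 : 0 < / d ^ 2) by (apply Rinv_0_lt_compat, pow_lt; easy).
      (* For [m = 1] the enlarged arc wraps around the circle and [K <= A]. *)
      destruct (Nat.le_gt_cases K A) as [H|H].
      - replace A with (K + (A - K))%nat by lia. rewrite rsum_app.
        assert (0 <= rsum (fun i => g y (K + i)%nat) (A - K)).
        { replace 0 with (rsum (fun _ => 0) (A - K)) by (rewrite rsum_const; ring).
          apply rsum_le; intros; apply fejer_nonneg. }
        assert (0 <= INR K * / d ^ 2) by (apply Rmult_le_pos; lra). lra.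
      - replace K with (A + (K - A))%nat at 1 by lia. rewrite rsum_app.
        apply Rplus_le_compat_l. apply Rle_trans with (INR (K - A) * / d ^ 2).
        + rewrite <- rsum_const. apply rsum_le; intros i Hi. apply Far; lia.
        + apply Rmult_le_compat_r; [lra|]. apply le_INR; lia. }
    (* The exponents 4 and 3 meet here: the claim reads [M^2 P^2 <= M P^3], that is [M <= P], so the
       far points hold at most the fraction [1 / P] of the grid sum. This is the loss compensated in
       [w]. *)
    assert (L2 : INR K * / d ^ 2 <= INR K * INR K * / P).
    { rewrite Rmult_assoc. apply Rmult_le_compat_l; [lra|].
      replace (/ d ^ 2) with (M ^ 2 * P ^ 2) by (unfold d; field; split; lra).
      replace (INR K * / P) with (M * P ^ 3) by (rewrite EK; field; lra).
      replace (M ^ 2 * P ^ 2) with (M * P ^ 2 * M) by ring.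
      replace (M * P ^ 3) with (M * P ^ 2 * P) by ring.
      apply Rmult_le_compat_l; [apply Rmult_le_pos; [lra|apply pow2_ge_0]|lra]. }
    apply Rle_trans with (w * (INR K * INR K * (1 - / P))).
    + right. unfold w. rewrite Rinv_l; lra.
    + apply Rmult_le_compat_l; lra.
  - split; [apply Rmult_le_pos; [lra|apply Rmult_le_pos; apply pos_INR]|].
    fold M. set (x := / P) in *.
    assert (E : w * (INR A * INR K) = / M * ((1 + 2 * x) / (1 - x))).
    { unfold w. rewrite EA, EK. unfold x. field. repeat split; lra. }
    rewrite E. assert (PM1 : 0 < / M <= 1).
    { split; [apply Rinv_0_lt_compat; lra|]. rewrite <- Rinv_1. apply Rinv_le_contravar; lra. }
    assert (Q : (1 + 2 * x) / (1 - x) <= 1 + 6 * x).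
    { apply Rmult_le_reg_r with (1 - x); [lra|].
      replace ((1 + 2 * x) / (1 - x) * (1 - x)) with (1 + 2 * x) by (field; lra). nra. }
    assert (6 * x <= eps).
    { apply Rmult_le_reg_r with P; [lra|]. unfold x. rewrite Rmult_assoc, Rinv_l by lra. lra. }
    apply Rle_trans with (/ M * (1 + 6 * x)); [apply Rmult_le_compat_l; lra|]. nra.
Qed.

Lemma pow_perturbation (a : R) k : 0 <= a ->
  exists Q, 0 <= Q /\ forall e, 0 <= e <= 1 -> (a + e) ^ k <= a ^ k + Q * e.
Proof.
  intros Ha. induction k as [|k (Q & HQ & IH)].
  - exists 0; split; [lra|]. intros; simpl; lra.
  - assert (0 <= a ^ k) by (apply pow_le; easy).
    (* The last [Q] absorbs the quadratic term [Q e^2 <= Q e]. *)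
    exists (a ^ k + a * Q + Q); split; [nra|]. intros e He. specialize (IH e He). simpl.
    apply Rle_trans with ((a + e) * (a ^ k + Q * e)); [apply Rmult_le_compat_l; lra|].
    assert (0 <= Q * e * (1 - e)) by (apply Rmult_le_pos; [apply Rmult_le_pos|]; lra). nra.
Qed.

Definition match_ind (u : nat -> Z) m B n : R := if block_match_dec u m B n then 1 else 0.

Lemma block_count_rsum u m B N : INR (block_count u m B N) = rsum (match_ind u m B) N.
Proof.
  unfold block_count. induction N as [|N IH]; [easy|].
  rewrite seq_S, filter_app, length_app, plus_INR, IH. simpl. f_equal.
  unfold match_ind. destruct (block_match_dec u m B N); easy.
Qed.

Lemma block_matchP u m B n : block_match_dec u m B n = true <->
  forall i, (i < length B)%nat -> (u (n + i)%nat mod m = nth i B 0%Z mod m)%Z.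
Proof.
  unfold block_match_dec. rewrite forallb_forall. split; intros H i Hi.
  - apply Z.eqb_eq, H, in_seq. lia.
  - apply Z.eqb_eq, H. apply in_seq in Hi. lia.
Qed.

Fixpoint freq_terms (q : R) (j : nat) (h : list Z) : list (R * R) :=
  match h with
  | nil => nil
  | f :: h' => (q * IZR f, INR j) :: freq_terms q (S j) h'
  end.

Lemma freq_terms_shifts q h : forall j,
  map snd (freq_terms q j h) = map INR (seq j (length h)).
Proof. induction h as [|f h IH]; intros j; simpl; [easy|]. rewrite IH; easy. Qed.

(** For [n >= 1] all bases [n + j] are positive, so [rpow] is [Rpower]; the base 0 follows a
    separate convention. *)
Lemma freq_terms_psum q c h : forall j n, (1 <= n)%nat ->
  psum (freq_terms q j h) c (INR n) = q * dot (fun j n => rpow (INR (n + j)) c) j h n.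
Proof.
  induction h as [|f h IH]; intros j n Hn; cbn [freq_terms dot].
  - unfold psum; simpl; ring.
  - unfold psum. rewrite lsum_cons. fold (psum (freq_terms q (S j) h) c (INR n)).
    rewrite IH by easy. cbn [fst snd]. unfold rpow at 2. rewrite plus_INR.
    assert (0 < INR n) by (apply lt_0_INR; lia). pose proof (pos_INR j).
    destruct (Rle_dec (INR n + INR j) 0); [lra|]. ring.
Qed.

Lemma dot_scal Y Z a h : (forall j n, Y j n = a * Z j n) ->
  forall j n, dot Y j h n = a * dot Z j h n.
Proof.
  intros E. induction h as [|f h IH]; intros j n; simpl; [ring|].
  rewrite IH, E; ring.
Qed.

Lemma power_block_weyl c (m : Z) k :
  (forall z : Z, c <> IZR z) -> (0 < m)%Z -> INR k <= c + 1 ->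
  forall h, length h = k -> Exists (fun f => f <> 0%Z) h ->
  mean_zero (fun n => cis (2 * PI * dot (fun j n => rpow (INR (n + j)) c / IZR m) 0 h n)).
Proof.
  intros Hc Hm Hk h Hh HE.
  assert (PM : 0 < IZR m) by (apply (IZR_lt 0); easy). pose proof PI_RGT_0 as HPI.
  set (q := 2 * PI / IZR m).
  assert (Hq : q <> 0).
  { unfold q, Rdiv. apply Rmult_integral_contrapositive_currified; [lra|].
    apply Rinv_neq_0_compat; lra. }
  assert (HS := freq_terms_shifts q h 0).
  apply mean_zero_eventually with
    (n0 := 1%nat) (w := fun n => cis (psum (freq_terms q 0 h) c (INR n))).
  - intros n Hn. rewrite freq_terms_psum by easy.
    rewrite (dot_scal _ (fun j n => rpow (INR (n + j)) c) (/ IZR m)).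
    + f_equal. unfold q; field; lra.
    + intros; field; lra.
  - apply mean_zero_power_combination; [easy| | | |].
    + assert (F : Forall (fun t => 0 <= t) (map snd (freq_terms q 0 h))).
      { rewrite HS. apply Forall_map, Forall_forall; intros; apply pos_INR. }
      rewrite Forall_map in F; exact F.
    + rewrite HS. apply Injective_map_NoDup; [|apply seq_NoDup].
      intros x y; apply INR_eq.
    + generalize 0%nat; clear HS Hh. induction HE as [f h Hf|f h _ IH]; intros j; simpl.
      * left; simpl. apply Rmult_integral_contrapositive_currified; [easy|].
        intros E; apply Hf, eq_IZR; easy.
      * right; apply IH.
    + rewrite <- (length_map snd), HS, length_map, length_seq, Hh; easy.
Qed.

(** Writing the integer part of [x] as [m z + b] gives [m z <= x - b < m z + 1]; divide by [m]. *)
Lemma match_arc (x : R) (m b : Z) : (0 < m)%Z -> (0 <= b < m)%Z ->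
  (Int_part x mod m = b mod m)%Z ->
  exists z, IZR z <= x / IZR m - IZR b / IZR m < IZR z + / IZR m.
Proof.
  intros Hm Hb E. rewrite (Z.mod_small b) in E by easy.
  assert (PM : 0 < IZR m) by (apply (IZR_lt 0); easy).
  pose proof (Z_div_mod_eq_full (Int_part x) m) as D. rewrite E in D.
  exists (Int_part x / m)%Z. set (z := (Int_part x / m)%Z) in *.
  apply (f_equal IZR) in D. rewrite plus_IZR, mult_IZR in D.
  pose proof (base_Int_part x) as [I1 I2].
  replace (IZR z) with (IZR m * IZR z / IZR m) by (field; lra).
  replace (/ IZR m) with (1 / IZR m) by (field; lra).
  unfold Rdiv. rewrite <- Rmult_minus_distr_r, <- Rmult_plus_distr_r.
  assert (0 < / IZR m) by (apply Rinv_0_lt_compat; easy).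
  split; [apply Rmult_le_compat_r|apply Rmult_lt_compat_r]; lra.
Qed.

Lemma tprod_majorant (t : nat -> R -> R) Y n k :
  (forall j y, 0 <= t j y) ->
  exists v, tprod (fun j y => RtoC (t j y)) Y k n = RtoC v /\ 0 <= v /\
    ((forall j, (j < k)%nat -> 1 <= t j (Y j n)) -> 1 <= v).
Proof.
  intros Ht. induction k as [|k (v & E & V0 & V1)]; simpl.
  - exists 1; repeat split; lra.
  - exists (v * t k (Y k n)); repeat split.
    + rewrite E, RtoC_mult; easy.
    + apply Rmult_le_pos; auto.
    + intros H. rewrite <- (Rmult_1_r 1). apply Rmult_le_compat; try lra.
      * apply V1; intros; apply H; lia.
      * apply H; lia.
Qed.

(** The product of [k] arc majorants, one per coordinate, is nonnegative and at least 1 whenever the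
    block matches; its mean is [mu^k]. *)
Lemma block_upper_bound c (m : Z) k B eps :
  (forall z : Z, c <> IZR z) -> (0 < m)%Z -> INR k <= c + 1 ->
  length B = k -> (forall b, In b B -> (0 <= b < m)%Z) -> 0 < eps ->
  exists N0, forall N, (N0 <= N)%nat ->
    INR (block_count (floor_pow c) m B N) <= (/ IZR m ^ k + eps) * INR N.
Proof.
  intros Hc Hm Hk HB Hb He.
  assert (PM : 0 < IZR m) by (apply (IZR_lt 0); easy).
  assert (PM' : 0 <= / IZR m) by (left; apply Rinv_0_lt_compat; easy).
  destruct (pow_perturbation (/ IZR m) k PM') as (Q & HQ & Pert).
  set (e := Rmin 1 (eps / 2 / (Q + 1))).
  assert (e1 : 0 < eps / 2 / (Q + 1)) by (repeat apply Rdiv_lt_0_compat; lra).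
  assert (e0 : 0 < e) by (apply Rmin_pos; lra).
  assert (e2 : Q * e <= eps / 2).
  { apply Rle_trans with ((Q + 1) * (eps / 2 / (Q + 1))).
    - apply Rmult_le_compat; try lra. apply Rmin_r.
    - right; field; lra. }
  destruct (arc_majorant m e Hm e0) as (t & mu & Ht & Ht0 & Ht1 & Hmu).
  assert (Hmuk : mu ^ k <= / IZR m ^ k + eps / 2).
  { apply Rle_trans with ((/ IZR m + e) ^ k); [apply pow_incr; lra|].
    eapply Rle_trans; [apply Pert; split; [lra|apply Rmin_l]|]. rewrite pow_inv. lra. }
  set (Y := fun j n => rpow (INR (n + j)) c / IZR m).
  (* Coordinate [j] is recentred at [b_j / m]. The default 0 only makes [tb] total: the product
     evaluates [j < k = length B]. *)
  set (tb := fun j y => t (y - IZR (nth j B 0%Z) / IZR m)).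
  assert (W := weyl_product (fun j y => RtoC (tb j y)) (RtoC mu) Y k
    (power_block_weyl c m k Hc Hm Hk)
    (fun j => trigpoly_translate _ _ _ Ht) k nil ltac:(simpl; lia)).
  destruct (W (eps / 2) ltac:(lra)) as [N0 HN0]. exists N0; intros N HN.
  specialize (HN0 N HN). rewrite block_count_rsum.
  assert (V : forall N, exists v, csum (tprod (fun j y => RtoC (tb j y)) Y k) N = RtoC v /\
    rsum (match_ind (floor_pow c) m B) N <= v).
  { induction N1 as [|n (v & E & Hv)]; simpl; [exists 0; split; [easy|lra]|].
    destruct (tprod_majorant tb Y n k) as (v' & E' & V0 & V1); [intros; apply Ht0|].
    exists (v + v'); split; [rewrite E, E', RtoC_plus; easy|].
    apply Rplus_le_compat; [easy|]. unfold match_ind.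
    destruct (block_match_dec (floor_pow c) m B n) eqn:EM; [|easy].
    apply V1. intros j Hj. unfold tb, Y.
    rewrite <- HB in Hj.
    pose proof (proj1 (block_matchP _ _ _ _) EM j Hj) as Hj'.
    destruct (match_arc _ _ _ Hm (Hb _ (nth_In B 0%Z Hj)) Hj') as [z Hz].
    apply (Ht1 _ z Hz). }
  destruct (V N) as (v & E & Hv).
  eapply Rle_trans; [apply Hv|].
  rewrite (csum_ext _ (fun n => tprod (fun j y => RtoC (tb j y)) Y k n + RtoC (- mu ^ k))%C)
    in HN0.
  - rewrite csum_plus, csum_const in HN0. unfold tb in HN0, E.
    rewrite E, <- RtoC_mult, <- RtoC_plus, Cmod_R in HN0.
    pose proof (Rle_abs (v + INR N * - mu ^ k)).
    apply Rmult_le_compat_r with (r := INR N) in Hmuk; [|apply pos_INR]. lra.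
  - intros n _. simpl. rewrite Rmult_0_r, cis_0, RtoC_opp, RtoC_pow. unfold zero_ind; simpl. ring.
Qed.

(** * From upper bounds to limits *)

Fixpoint all_blocks (m k : nat) : list (list Z) :=
  match k with
  | O => nil :: nil
  | S k' => flat_map (fun b => map (cons (Z.of_nat b)) (all_blocks m k')) (seq 0 m)
  end.

Lemma all_blocks_length m k : length (all_blocks m k) = (m ^ k)%nat.
Proof.
  induction k as [|k IH]; simpl; [easy|].
  rewrite flat_map_constant_length with (c := (m ^ k)%nat).
  - rewrite length_seq; easy.
  - intros; rewrite length_map; easy.
Qed.

Lemma in_all_blocks m k B : In B (all_blocks m k) <->
  length B = k /\ forall b, In b B -> (0 <= b < Z.of_nat m)%Z.
Proof.
  revert B; induction k as [|k IH]; intros B; simpl.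
  - split.
    + intros [<-|[]]; split; easy.
    + intros [H _]. left. destruct B; easy.
  - rewrite in_flat_map. split.
    + intros (b & Hb & H). apply in_map_iff in H as (B' & <- & H).
      apply IH in H as [H1 H2]. apply in_seq in Hb. split; [simpl; lia|].
      intros x [<-|Hx]; [lia|auto].
    + intros [H1 H2]. destruct B as [|b B]; [easy|].
      assert (Hb := H2 b (or_introl eq_refl)).
      exists (Z.to_nat b). split; [apply in_seq; lia|].
      rewrite Z2Nat.id by lia. apply in_map, IH. split; [simpl in H1; lia|].
      intros x Hx; apply H2; right; easy.
Qed.

Definition total_count (u : nat -> Z) m (l : list (list Z)) N : R :=
  fold_right (fun B r => INR (block_count u m B N) + r) 0 l.

Lemma total_count_app u m l l' N :
  total_count u m (l ++ l') N = total_count u m l N + total_count u m l' N.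
Proof. induction l as [|B l IH]; simpl; [ring|]. unfold total_count in *; simpl. rewrite IH; ring. Qed.

Lemma total_count_S u m l N :
  total_count u m l (S N) =
  total_count u m l N + fold_right (fun B r => match_ind u m B N + r) 0 l.
Proof.
  unfold total_count. induction l as [|B l IH]; simpl; [ring|].
  rewrite IH, !block_count_rsum. simpl. ring.
Qed.

(** The block of residues read at position [N] is in the list and matches there, so the total grows
    by at least 1 at each step. *)
Lemma all_blocks_cover u m k N : (0 < m)%Z ->
  INR N <= total_count u m (all_blocks (Z.to_nat m) k) N.
Proof.
  intros Hm. induction N as [|N IH].
  - unfold total_count. induction (all_blocks _ _) as [|B l IHl]; simpl; [lra|].
    unfold block_count in *; simpl in *; lra.
  - rewrite S_INR, total_count_S. apply Rplus_le_compat; [easy|].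
    set (B := map (fun i => u (N + i)%nat mod m)%Z (seq 0 k)).
    assert (LB : length B = k) by (unfold B; rewrite length_map, length_seq; easy).
    assert (HB : In B (all_blocks (Z.to_nat m) k)).
    { apply in_all_blocks. split; [easy|]. intros b Hb. apply in_map_iff in Hb as (i & <- & _).
      rewrite Z2Nat.id by lia. apply Z.mod_pos_bound; easy. }
    assert (HM : match_ind u m B N = 1).
    { unfold match_ind. replace (block_match_dec u m B N) with true; [easy|].
      symmetry. apply block_matchP. intros i Hi. unfold B.
      (* [map_nth] expects a default that is an image under the mapped function. *)
      rewrite nth_indep with (d' := (u (N + 0)%nat mod m)%Z) by easy.
      rewrite map_nth with (f := fun i => (u (N + i)%nat mod m)%Z).
      rewrite seq_nth by lia. rewrite Z.mod_mod by lia. easy. }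
    assert (P : forall l, 0 <= fold_right (fun B r => match_ind u m B N + r) 0 l).
    { induction l as [|B' l IHl]; simpl; [lra|]. unfold match_ind at 1.
      destruct block_match_dec; lra. }
    clear IH. induction (all_blocks _ _) as [|B' l IHl]; [easy|]. simpl.
    destruct HB as [->|HB].
    + specialize (P l). lra.
    + specialize (IHl HB). unfold match_ind at 1. destruct block_match_dec; lra.
Qed.

Lemma total_count_upper u m (a : R) l :
  (forall B, In B l -> exists N0, forall N, (N0 <= N)%nat ->
     INR (block_count u m B N) <= a * INR N) ->
  exists N0, forall N, (N0 <= N)%nat ->
    total_count u m l N <= INR (length l) * (a * INR N).
Proof.
  induction l as [|B l IH]; intros H.
  - exists O; intros; simpl. lra.
  - destruct (H B (or_introl eq_refl)) as [N1 H1].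
    destruct IH as [N2 H2]; [intros; apply H; right; easy|].
    exists (max N1 N2); intros N HN.
    specialize (H1 N ltac:(lia)). specialize (H2 N ltac:(lia)).
    cbn [length]. rewrite S_INR. unfold total_count in *; cbn [fold_right]. lra.
Qed.

Theorem theorem1 (c : R) (m : Z) :
  1 < c ->
  (forall z : Z, c <> IZR z) ->
  (0 < m)%Z ->
  forall k : nat, (1 <= k)%nat -> INR k <= c + 1 ->
    k_unif_distr_mod (floor_pow c) m k.
Proof.
  intros _ Hc Hm k _ Hk B HB Hb eps He.
  set (M := IZR m ^ k).
  assert (PM : 1 <= M) by (apply pow_R1_Rle, (IZR_le 1); lia).
  assert (U : forall B e, length B = k -> (forall b, In b B -> (0 <= b < m)%Z) -> 0 < e ->
    exists N0, forall N, (N0 <= N)%nat ->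
      INR (block_count (floor_pow c) m B N) <= (/ M + e) * INR N).
  { intros; apply block_upper_bound; easy. }
  assert (V : forall B, In B (all_blocks (Z.to_nat m) k) ->
    length B = k /\ (forall b, In b B -> (0 <= b < m)%Z)).
  { intros B' H. apply in_all_blocks in H. rewrite Z2Nat.id in H by lia. easy. }
  assert (HIn : In B (all_blocks (Z.to_nat m) k)).
  { apply in_all_blocks. rewrite Z2Nat.id by lia. easy. }
  destruct (in_split _ _ HIn) as (l1 & l2 & Hl).
  assert (HL : INR (length (l1 ++ l2)) = M - 1).
  { pose proof (all_blocks_length (Z.to_nat m) k) as L. rewrite Hl, length_app in L. simpl in L.
    apply (f_equal INR) in L. rewrite pow_INR, (INR_IZR_INZ (Z.to_nat m)), Z2Nat.id in L by lia.
    rewrite plus_INR, S_INR in L. rewrite length_app, plus_INR. unfold M. lra. }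
  (* The errors of the [M - 1] other blocks then add up to less than [eps / 2]. *)
  set (e := eps / 2 / M).
  assert (Pe : 0 < e) by (repeat apply Rdiv_lt_0_compat; lra).
  assert (Ee : e * M = eps / 2) by (unfold e; field; lra).
  destruct (total_count_upper (floor_pow c) m (/ M + e) (l1 ++ l2)) as [N1 H1].
  { intros B' H. assert (H' : In B' (all_blocks (Z.to_nat m) k)).
    { rewrite Hl. apply in_app_iff. apply in_app_iff in H. simpl. tauto. }
    apply V in H' as [? ?]. apply U; easy. }
  destruct (U B (eps / 2) HB Hb ltac:(lra)) as [N2 H2].
  exists (S (max N1 N2)); intros N HN.
  specialize (H1 N ltac:(lia)). specialize (H2 N ltac:(lia)).
  assert (PN : 0 < INR N) by (apply lt_0_INR; lia).
  pose proof (all_blocks_cover (floor_pow c) m k N Hm) as H3.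
  rewrite Hl, total_count_app in H3. rewrite total_count_app in H1.
  change (total_count (floor_pow c) m (B :: l2) N) with
    (INR (block_count (floor_pow c) m B N) + total_count (floor_pow c) m l2 N) in H3.
  rewrite HL in H1. set (x := INR (block_count (floor_pow c) m B N)) in *.
  replace ((M - 1) * ((/ M + e) * INR N)) with
    ((1 - / M + e * M - e) * INR N) in H1 by (field; lra).
  rewrite Ee in H1.
  (* The cover gives [x >= N - (1 - / M + eps / 2 - e) N]; the surplus [e N] is dropped. *)
  assert (H4 : (/ M - eps / 2) * INR N <= x) by nra.
  unfold R_dist. apply Rle_lt_trans with (eps / 2); [|lra].
  apply Rabs_le. split.
  - apply Rmult_le_reg_r with (INR N); [easy|].
    replace ((x / INR N - / M) * INR N) with (x - / M * INR N) by (field; lra). lra.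
  - apply Rmult_le_reg_r with (INR N); [easy|].
    replace ((x / INR N - / M) * INR N) with (x - / M * INR N) by (field; lra). lra.
Qed.
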